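(* Let $k$ be a field, let $R = k[x,y,z]$ with the standard grading, and let $f_1,f_2,f_3 \in R$ be homogeneous of degrees $d_1,d_2,d_3$. Suppose that $I = \langle f_1,f_2,f_3\rangle \subseteq R$ has codimension two. Let $K$ be the module of Koszul syzygies on $f_1,f_2,f_3$, and let $V$ be the module of syzygies on $f_1,f_2,f_3$ which vanish at the basepoint locus $Z = \mathbf{V}(I) \subseteq \mathbb{P}^2$. Then $K = V$ if and only if $I$ is a local complete intersection.
   Context: $R(i)$ denotes the shift in grading $R(i)_j = R_{i+j}$. $\mathbb{P}^2$ is the projective plane over $k$ with homogeneous coordinate ring $R$. Since $I$ has codimension two, $Z = \mathbf{V}(I)$ is a zero-dimensional subscheme of $\mathbb{P}^2$, called the base point locus of $f_1,f_2,f_3$. The module of Koszul syzygies is the submodule $K \subseteq \bigoplus_{j=1}^3 R(-d_j)$ generated by $(f_2,-f_1,0)$, $(f_3,0,-f_1)$ and $(0,f_3,-f_2)$. A syzygy on $f_1,f_2,f_3$ is a triple $(a_1,a_2,a_3) \in \bigoplus_{j=1}^3 R(-d_j)$ with $a_1f_1+a_2f_2+a_3f_3 = 0$. The saturation of $I$ is $I^{sat} = \{f \in R \mid \langle x,y,z\rangle^n f \subseteq I \text{ for some } n \geq 0\}$. A syzygy $(a_1,a_2,a_3)$ vanishes at the basepoint locus $Z$ if $a_i \in I^{sat}$ for $i=1,2,3$; $V$ denotes the module of all such syzygies. $I$ is a local complete intersection if it is locally generated by a regular sequence on $\mathbb{P}^2$: for every point $p \in Z$, the localization $\mathcal{I}_p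 \subseteq \mathcal{O}_{\mathbb{P}^2,p}$ of (the ideal sheaf of) $I$ at $p$ is generated by a regular sequence. *)

(* Defs.v *)
From HB Require Import structures.
From mathcomp Require Import all_boot all_order all_algebra.
From mathcomp Require Import mpoly.
From mathcomp Require Import boolp classical_sets.

Set Implicit Arguments.
Unset Strict Implicit.
Unset Printing Implicit Defensive.

Import GRing.Theory.
Local Open Scope ring_scope.
Local Open Scope classical_set_scope.

Section Ideals.
Variable A : comNzRingType.

Definition submod_gen (V : lmodType A) (S : set V) : set V :=
  [set v | exists n (c : 'I_n -> A) (g : 'I_n -> V),
     (forall i, S (g i)) /\ v = \sum_i c i *: g i].

Definition ideal_gen (S : set A) : set A := submod_gen (V := A^o) S.

Definition ideal_mul (I J : set A) : set A :=
  ideal_gen [set x | exists a b, [/\ I a, J b & x = a * b]].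

Definition ideal_exp (I : set A) (n : nat) : set A :=
  iter n (ideal_mul I) setT.

(* The second clause says that the quotient by the whole sequence is nonzero. *)
Definition regular_seq (s : seq A) : Prop :=
  (forall i, (i < size s)%N -> forall x,
     ideal_gen [set` take i s] (s`_i * x) -> ideal_gen [set` take i s] x)
  /\ ~ ideal_gen [set` s] 1.

Definition height_ge (P : prime_idealr A) (n : nat) : Prop :=
  exists c : nat -> prime_idealr A,
    (forall i, (i < n)%N -> [set` c i] `<` [set` c i.+1])
    /\ [set` c n] = [set` P].

(* The codimension of an ideal is the minimum of the heights of the prime     *)
(* ideals containing it; the unit ideal has no codimension in nat.            *)
Definition has_codim (I : set A) (n : nat) : Prop :=
  (forall P : prime_idealr A, I `<=` [set` P] -> height_ge P n)
  /\ (exists P : prime_idealr A,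
        [/\ I `<=` [set` P], height_ge P n & ~ height_ge P n.+1]).

End Ideals.

(* Points of the scheme P^2 = Proj k[x,y,z]: the homogeneous prime ideals that *)
(* do not contain the irrelevant ideal <x,y,z>. They need not be k-rational.  *)
Record proj_point (k : fieldType) := ProjPoint {
  point_ideal :> prime_idealr {mpoly k[3]};
  point_homog : forall (f : {mpoly k[3]}) (d : nat),
    f \in point_ideal -> pihomog mdeg d f \in point_ideal;
  point_relevant : exists i : 'I_3, 'X_i \notin point_ideal
}.

Section LocalRing.
Variables (k : fieldType) (p : proj_point k).
Local Notation R := {mpoly k[3]}.
Local Notation "x %:F" := (@FracField.tofrac R x).

(* Fractions a / s of degree 0 with a in I and s not in p.                    *)
Definition hfrac (I : set R) : set {fraction R} :=
  [set x | exists (d : nat) (a s : R),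
     [/\ a \is d.-homog, s \is d.-homog, I a, s \notin p & x = a%:F / s%:F]].

Definition local_pred : {pred {fraction R}} := fun x => `[< hfrac setT x >].

Lemma local_pred_subring : subring_closed local_pred.
Proof.
have nz (s : R) : s \notin p -> s%:F != 0.
  by apply: contraNneq => /eqP; rewrite tofrac_eq0 => /eqP ->; apply: rpred0.
have np (s t : R) : s \notin p -> t \notin p -> s * t \notin p.
  by move=> sp tp; rewrite prime_idealrM negb_or sp.
split.
- apply/asboolP; exists 0%N, 1, 1; split; rewrite ?dhomog1 //.
    by rewrite idealr1.
  by rewrite tofrac1 divr1.
- move=> x y /asboolP[d [a [s [ad sd _ sp ->]]]].
  move=> /asboolP[e [b [t [be te _ tp ->]]]].
  apply/asboolP; exists (d + e)%N, (a * t - b * s), (s * t); split=> //.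
  + by apply: rpredB; [|rewrite mulrC]; apply: dhomogM.
  + exact: dhomogM.
  + exact: np.
  + by rewrite -mulNr addf_div ?nz // mulNr tofracB !tofracM.
- move=> x y /asboolP[d [a [s [ad sd _ sp ->]]]].
  move=> /asboolP[e [b [t [be te _ tp ->]]]].
  apply/asboolP; exists (d + e)%N, (a * b), (s * t); split=> //.
  + exact: dhomogM.
  + exact: dhomogM.
  + exact: np.
  + by rewrite mulf_div !tofracM.
Qed.

HB.instance Definition _ :=
  GRing.isSubringClosed.Build {fraction R} local_pred local_pred_subring.

(* The local ring of P^2 at p: the degree 0 part of the homogeneous           *)
(* localization of k[x,y,z] at p, as a subring of the field k(x,y,z).         *)
Record local_ring := LocalRing {
  local_val :> {fraction R};
  local_valP : local_val \in local_pred
}.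
HB.instance Definition _ := [isSub for local_val].
HB.instance Definition _ := [Choice of local_ring by <:].
HB.instance Definition _ := [SubChoice_isSubComNzRing of local_ring by <:].

(* The stalk at p of the ideal sheaf of the homogeneous ideal I.              *)
Definition ideal_stalk (I : set R) : set local_ring :=
  [set x | hfrac I (val x)].

End LocalRing.

Arguments ideal_stalk {k} p I.

Section Syzygies.
Variable k : fieldType.
Local Notation R := {mpoly k[3]}.

Definition local_complete_intersection (I : set R) : Prop :=
  forall p : proj_point k, I `<=` [set` point_ideal p] ->
    exists s : seq (local_ring p),
      regular_seq s /\ ideal_stalk p I = ideal_gen [set` s].

Definition irrelevant_ideal : set R := ideal_gen [set 'X_i | i in [set: 'I_3]].

Definition saturation (I : set R) : set R :=
  [set f | exists n, forall g, ideal_exp irrelevant_ideal n g -> I (g * f)].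

Definition row3 (a b c : R) : 'rV[R]_3 := \row_j [tuple a; b; c]`_j.

(* Degree shifts of the summands do not affect the modules below, which are   *)
(* given as subsets of the ungraded module R^3 underlying the sum of the      *)
(* R(-d_j).                                                                   *)
Definition syzygies (f1 f2 f3 : R) : set 'rV[R]_3 :=
  [set a : 'rV[R]_3 | \sum_j a 0 j * row3 f1 f2 f3 0 j = 0].

Definition koszul_syzygies (f1 f2 f3 : R) : set 'rV[R]_3 :=
  submod_gen [set row3 f2 (- f1) 0; row3 f3 0 (- f1); row3 0 f3 (- f2)].

Definition vanishing_syzygies (f1 f2 f3 : R) : set 'rV[R]_3 :=
  [set a : 'rV[R]_3 | syzygies f1 f2 f3 a /\
           forall j, saturation (ideal_gen [set f1; f2; f3]) (a 0 j)].

End Syzygies.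

(* Main.v *)
From HB Require Import structures.
Require Import Defs.
From mathcomp Require Import all_boot all_order all_algebra.
From mathcomp Require Import perm mpoly.
From mathcomp Require Import boolp classical_sets.
From mathcomp Require Import zify ring.

(** Write [f] for the triple of generators. As [R] is factorial and [I] lies in
    no principal prime, the second Koszul homology of [f] vanishes.

    If [I] is a local complete intersection, then locally [I] has a regular
    sequence of generators, whose syzygies are all Koszul; rewriting [f] through
    these generators and back shows that a syzygy of [f] with entries in [I] is
    locally Koszul. The Koszul syzygies form a second syzygy module, hence a
    saturated one, so the local statement globalizes.

    Conversely, assume [K = V] and let [p] contain [I], with maximal ideal [m] in
    an affine chart [k[s][t]]. Then [m] is generated by a prime [u] of [k[s]] and
    some [v]. Reducing modulo [u], the syzygy module is free of rank two at [p],
    so if all syzygies of [f] had entries in [m], then the Koszul syzygies would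
    lie in [m] times the syzygies (Hilbert-Burch). In that case the complex

      [0 -> S -> Syz^3 + S^3 -> S^9 + Syz -> S^3],

    which is exact because [K = V] on the chart, would end in a map with entries
    in [m]; lifting along [u], [v] (there is no third Tor over a regular local
    ring of dimension two) gives [1 \in m] at [p]. So some syzygy has a unit
    entry at [p]: two of the three generators suffice there, and they form a
    regular sequence because [I] has grade two. *)

Set Implicit Arguments.
Unset Strict Implicit.
Unset Printing Implicit Defensive.

Import GRing.Theory.
Local Open Scope ring_scope.
Local Open Scope classical_set_scope.

(** * Prime ideals and factorial rings *)

Section PrimeIdeals.
Variable A : comNzRingType.

Definition dvdr (a b : A) : Prop := exists c, b = a * c.

(** Ideals are [Prop]-valued predicates because most of those used below are given by existential
    formulas. *)
Record ideal_pred (P : A -> Prop) : Prop := IdealPred {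
  ideal_pred0 : P 0;
  ideal_predD : forall a b, P a -> P b -> P (a + b);
  ideal_predM : forall a b, P b -> P (a * b) }.

Record prime_pred (P : A -> Prop) : Prop := PrimePred {
  prime_predI :> ideal_pred P;
  prime_pred1 : ~ P 1;
  prime_predP : forall a b, P (a * b) -> P a \/ P b }.

Lemma ideal_pred_sum P (I : Type) (r : seq I) (Q : pred I) (F : I -> A) :
  ideal_pred P -> (forall i, Q i -> P (F i)) -> P (\sum_(i <- r | Q i) F i).
Proof.
by move=> iP PF; apply: big_ind => //; [exact: ideal_pred0|exact: ideal_predD].
Qed.

Lemma ideal_predN P a : ideal_pred P -> P a -> P (- a).
Proof. by move=> iP Pa; rewrite -mulN1r; apply: ideal_predM. Qed.

Lemma ideal_predB P a b : ideal_pred P -> P a -> P b -> P (a - b).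
Proof. by move=> iP Pa Pb; apply: ideal_predD => //; apply: ideal_predN. Qed.

Lemma dvdr_ideal a : ideal_pred (dvdr a).
Proof.
split; first by exists 0; rewrite mulr0.
  by move=> _ _ [b ->] [c ->]; exists (b + c); rewrite mulrDr.
by move=> b _ [c ->]; exists (b * c); rewrite mulrCA.
Qed.

Lemma prime_predX P a n : prime_pred P -> P (a ^+ n) -> P a.
Proof.
move=> pP; elim: n => [|n IHn]; first by rewrite expr0 => /(prime_pred1 pP).
by rewrite exprS => /(prime_predP pP) [].
Qed.

(** Gauss's lemma: if [i] and [j] are the least indices of coefficients outside [P], the coefficient
    of index [i + j] of the product is congruent modulo [P] to the product of these two. *)
Lemma prime_pred_coef (P : A -> Prop) (a b : {poly A}) : prime_pred P ->
  (forall i, P (a * b)`_i) -> (forall i, P a`_i) \/ (forall i, P b`_i).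
Proof.
move=> pP Pab; apply: contrapT => /not_orP [/existsNP exa /existsNP exb].
have {}exa : exists i, ~~ `[< P a`_i >].
  by case: exa => i Hi; exists i; apply/negP => /asboolP.
have {}exb : exists i, ~~ `[< P b`_i >].
  by case: exb => i Hi; exists i; apply/negP => /asboolP.
case: (ex_minnP exa) => i /asboolPn Pi mini.
case: (ex_minnP exb) => j /asboolPn Pj minj.
have lti m : (m < i)%N -> P a`_m.
  by move=> ltmi; apply/asboolP; apply: contraLR ltmi => /mini; rewrite -leqNgt.
have ltj m : (m < j)%N -> P b`_m.
  by move=> ltmj; apply/asboolP; apply: contraLR ltmj => /minj; rewrite -leqNgt.
have ltiS : (i < (i + j).+1)%N by rewrite ltnS leq_addr.
have := Pab (i + j)%N; rewrite coefM (bigD1 (Ordinal ltiS)) //= addKn => Pij.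
suff Pab' : P (a`_i * b`_j) by case: (prime_predP pP Pab').
set s := \sum_(_ < _ | _) _ in Pij.
have Ps : P s.
  apply: ideal_pred_sum => [|l nli]; first exact: pP.
  have [ltli|leil] := ltnP l i.
    by rewrite mulrC; apply: ideal_predM; [exact: pP|exact: lti].
  apply: ideal_predM; first exact: pP.
  apply: ltj; rewrite ltn_subLR; last by rewrite -ltnS ltn_ord.
  by rewrite ltn_add2r ltn_neqAle leil andbT eq_sym.
by rewrite -[_ * _](addrK s); apply: ideal_predB => //; exact: pP.
Qed.

End PrimeIdeals.

Section PrimeElements.

Definition prime_elt (A : comNzRingType) (q : A) := q != 0 /\ prime_pred (dvdr q).

Definition prime_factored (A : idomainType) (a : A) : Prop :=
  exists u (s : seq A), [/\ u \is a GRing.unit, forall q, q \in s -> prime_elt q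
    & a = u * \prod_(q <- s) q].

Definition factorial_ring (A : idomainType) : Prop :=
  forall a : A, a != 0 -> prime_factored a.

Lemma factorial_field (F : fieldType) : factorial_ring F.
Proof.
by move=> a a0; exists a, [::]; rewrite unitfE big_nil mulr1; split.
Qed.

Lemma prime_factoredM (A : idomainType) (a b : A) :
  prime_factored a -> prime_factored b -> prime_factored (a * b).
Proof.
move=> [u [s [Uu ps ->]]] [v [t [Uv pt ->]]]; exists (u * v), (s ++ t); split.
- by rewrite unitrM Uu.
- by move=> q; rewrite mem_cat => /orP [/ps|/pt].
- by rewrite big_cat /= mulrACA.
Qed.

Variable A : idomainType.

(* [dvdr] types the quotient through another canonical path, on which lemmas  *)
(* about [size] over the domain [A] would not chain with [lia].               *)
Lemma dvdr_polyP (q p : {poly A}) : dvdr q p -> exists w : {poly A}, p = q * w.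
Proof. by case=> w ->; exists w. Qed.

Lemma dvdr_polyC (q : A) (p : {poly A}) : dvdr q%:P p <-> forall i, dvdr q p`_i.
Proof.
split=> [[w ->] i|Hq]; first by exists w`_i; rewrite coefCM.
have [c Hc] := choice Hq.
exists (\poly_(i < size p) c i); apply/polyP => i; rewrite coefCM coef_poly.
by case: ltnP => [_|/(nth_default 0) ->]; rewrite ?mulr0.
Qed.

Lemma prime_elt_polyC (q : A) : prime_elt q -> prime_elt q%:P.
Proof.
case=> q0 pq; split; first by rewrite polyC_eq0.
split; first exact: dvdr_ideal.
  by move/dvdr_polyC/(_ 0%N); rewrite coef1; apply: prime_pred1.
move=> a b /dvdr_polyC /(prime_pred_coef pq).
by case=> H; [left|right]; apply/dvdr_polyC.
Qed.

Definition primitive (p : {poly A}) := forall q : A, prime_elt q -> ~ dvdr q%:P p.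

(** The prime factors of [c] cancel one at a time: each divides [q] times the quotient, hence the
    quotient, as [q] is primitive. *)
Lemma gauss_dvdr (c : A) (q p : {poly A}) : factorial_ring A -> c != 0 ->
  primitive q -> dvdr q (c *: p) -> dvdr q p.
Proof.
move=> fA c0 primq; case: (fA c c0) => u [s [Uu ps ->]] {c c0}.
elim: s p ps => [|r s IHs] p ps.
  rewrite big_nil mulr1 => -[w E]; exists (u^-1 *: w).
  by rewrite -scalerAr -E scalerA mulVr // scale1r.
rewrite big_cons => -[w E].
have pr : prime_elt r by apply: ps; rewrite mem_head.
have [r0 rP] := prime_elt_polyC pr.
have : dvdr r%:P (q * w).
  by exists ((u * \prod_(j <- s) j) *: p); rewrite -E mul_polyC scalerA mulrCA.
case/(prime_predP rP) => [/(primq _ pr)//|[w' Ew]].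
apply: IHs; first by move=> x xs; apply: ps; rewrite inE xs orbT.
exists w'; apply: (mulfI r0); rewrite mul_polyC scalerA mulrCA E Ew.
by rewrite mulrCA.
Qed.

Lemma prime_elt_dvd_prod (q u : A) (s : seq A) : prime_elt q ->
  u \is a GRing.unit -> dvdr q (u * \prod_(r <- s) r) ->
  exists2 r, r \in s & dvdr q r.
Proof.
case=> _ pq Uu /(prime_predP pq) [[w Ew]|].
  by case: (prime_pred1 pq); exists (w * u^-1); rewrite mulrA -Ew mulrV.
elim: s => [|r s IHs]; first by rewrite big_nil => /(prime_pred1 pq).
rewrite big_cons => /(prime_predP pq) [qr|/IHs [x xs qx]].
  by exists r; rewrite ?mem_head.
by exists x; rewrite // inE xs orbT.
Qed.

Lemma prime_elt_assoc (q r : A) : prime_elt q -> prime_elt r ->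
  dvdr q r -> dvdr r q.
Proof.
move=> [q0 pq] [r0 pr] [e Ee].
have : dvdr r (q * e) by exists 1; rewrite mulr1.
case/(prime_predP pr) => // -[d Ed]; case: (prime_pred1 pq); exists d.
by apply: (mulfI r0); rewrite mulr1 mulrCA -Ed.
Qed.

(** Induction on the number of prime factors of the leading coefficient: a prime dividing [p] is
    associate to one of them, which is then split off. *)
Lemma primitive_part (p : {poly A}) : factorial_ring A -> p != 0 ->
  exists c p0, [/\ c != 0, primitive p0 & p = c *: p0].
Proof.
move=> fA p0; have lp0 : lead_coef p != 0 by rewrite lead_coef_eq0.
case: (fA _ lp0) => u [s [Uu ps]] {lp0}.
have [n] := ubnP (size s); elim: n s p p0 ps => // n IHn s p p0 ps lts Ep.
have [prim|] := pselect (primitive p).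
  by exists 1, p; rewrite oner_eq0 scale1r.
move=> /existsNP [q] /not_implyP [pq] /contrapT qp.
have [|r rs qr] := @prime_elt_dvd_prod q u s pq Uu.
  by rewrite -Ep; move/dvdr_polyC: qp; apply.
have pr := ps _ rs.
have [w Ew] : dvdr r%:P p.
  have [e Ee] := prime_elt_assoc pq pr qr; have [w Ew] := qp.
  by exists (e%:P * w); rewrite Ew mulrA -polyCM -Ee.
have w0 : w != 0 by apply: contraNneq p0 => w0; rewrite Ew w0 mulr0.
have r0 : r != 0 by case: pr.
have [||||c [w' [c0 prim Ew']]] := IHn (rem r s) w.
- by [].
- by move=> x /mem_rem /ps.
- by rewrite size_rem // -ltnS prednK //; case: (s) rs.
- apply: (mulfI r0); rewrite -lead_coefZ -mul_polyC -Ew Ep (big_rem r) //=.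
  by rewrite mulrCA.
exists (r * c), w'; split=> //; first by rewrite mulf_neq0.
by rewrite -scalerA -Ew' -mul_polyC.
Qed.

(** Induction on the degree. Once the content is split off, a nonconstant primitive divisor of least
    degree is shown to be prime. *)
Lemma factorial_poly : factorial_ring A -> factorial_ring {poly A}.
Proof.
move=> fA p; have [n] := ubnP (size p); elim: n p => // n IHn p ltpn p0.
have [c [p1 [c0 prim1 Ep]]] := primitive_part fA p0.
have p10 : p1 != 0 by apply: contraNneq p0 => z; rewrite Ep z scaler0.
have sp1 : size p1 = size p by rewrite Ep size_scale.
rewrite Ep -mul_polyC; apply: prime_factoredM.
  have [u [s [Uu ps ->]]] := fA c c0; exists u%:P, (map polyC s); split.
  - by rewrite rmorph_unit.
  - by move=> _ /mapP [q /ps pq ->]; apply: prime_elt_polyC.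
  - by rewrite big_map rmorphM rmorph_prod.
have [le1|gt1] := leqP (size p1) 1.
  have E := size1_polyC le1; set a := p1`_0 in E.
  have a0 : a != 0 by rewrite -polyC_eq0 -E.
  have [u [s [Uu ps Ea]]] := fA a a0; rewrite E Ea.
  case: s ps Ea => [|r s] ps Ea.
    by exists u%:P, [::]; rewrite !big_nil !mulr1 rmorph_unit.
  have pr : prime_elt r by apply: ps; rewrite mem_head.
  case: (prim1 _ pr); exists (u * \prod_(q <- s) q)%:P.
  by rewrite E Ea big_cons -polyCM mulrCA.
have exq : exists m, `[< exists q : {poly A}, [/\ size q = m, (1 < m)%N, primitive q
    & dvdr q p1 ] >].
  by exists (size p1); apply/asboolP; exists p1; split=> //; exists 1; rewrite mulr1.
case: (ex_minnP exq) => m /asboolP [q [sq gtm primq /dvdr_polyP [w Ew]]] minm.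
have q0 : q != 0 by rewrite -size_poly_gt0 sq ltnW.
have w0 : w != 0 by apply: contraNneq p10 => z; rewrite Ew z mulr0.
have pq : prime_elt q.
  split=> //; split; first exact: dvdr_ideal.
    case/dvdr_polyP=> v Ev; have v0 : v != 0.
      by apply/eqP => z; move/eqP: Ev; rewrite z mulr0 oner_eq0.
    have := size_mul q0 v0; rewrite -Ev size_poly1 sq => /esym E1.
    by have : (0 < size v)%N; [rewrite size_poly_gt0|lia].
  move=> a b qab; have [a0|a0] := eqVneq a 0.
    by left; rewrite a0; exists 0; rewrite mulr0.
  (* The gcd of [q] and [a] is taken over the fraction field; its primitive part [g1] divides both
     over [A] by Gauss's lemma. *)
  have g0 : gcdp q a != 0 by rewrite gcdp_eq0 negb_and q0.
  have [d [g1 [d0 primg Eg]]] := primitive_part fA g0.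
  have /Pdiv.Idomain.dvdpP [[e v] /= e0 Eqv] := dvdp_gcdl q a.
  have /Pdiv.Idomain.dvdpP [[e' v'] /= e'0 Eav] := dvdp_gcdr q a.
  have g1q : dvdr g1 q.
    apply: (@gauss_dvdr e) => //; exists (d *: v).
    by rewrite Eqv Eg -!mul_polyC mulrCA mulrA [g1 * _]mulrC; ring.
  have g1a : dvdr g1 a.
    apply: (@gauss_dvdr e') => //; exists (d *: v').
    by rewrite Eav Eg -!mul_polyC; ring.
  have g10 : g1 != 0 by apply: contraNneq g0 => z; rewrite Eg z scaler0.
  have [gt1g|le1g] := ltnP 1 (size g1).
    (* By minimality [g1] has the size of [q], so the two differ by a constant. *)
    left; have [x Ex] := dvdr_polyP g1q; have [y Ey] := g1a.
    have x0 : x != 0 by apply: contraNneq q0 => z; rewrite Ex z mulr0.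
    have : (m <= size g1)%N.
      apply: minm; apply/asboolP; exists g1; split=> //.
      by exists (x * w); rewrite Ew Ex mulrA.
    have : (0 < size x)%N by rewrite size_poly_gt0.
    have := size_mul g10 x0; rewrite -Ex sq => Em x_gt0 le_x.
    have Ex0 : x = (x`_0)%:P by apply: size1_polyC; clear -Em x_gt0 le_x; lia.
    apply: (@gauss_dvdr x`_0) => //; first by rewrite -polyC_eq0 -Ex0.
    by exists y; rewrite Ey -mul_polyC -Ex0 Ex; ring.
  (* The gcd is a constant, so a Bezout relation times [b] shows that [q] divides a constant
     multiple of [b]. *)
  right; have Eg1 := size1_polyC le1g.
  have [[u v0] /= /Pdiv.Idomain.eqpP [[c1 c2] /= /andP [c10 c20] E]] := Pdiv.Idomain.Bezoutp q a.
  apply: (@gauss_dvdr (c2 * d * g1`_0)) => //.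
    by rewrite !mulf_neq0 // -polyC_eq0 -Eg1.
  have [z Ez] := qab; exists (c1 *: (u * b + v0 * z)).
  have -> : (c2 * d * g1`_0) *: b = (c2 *: gcdp q a) * b.
    by rewrite Eg {2}Eg1 -!mul_polyC !polyCM; ring.
  rewrite -E -!mul_polyC; transitivity (c1%:P * (u * q * b + v0 * (a * b))); first by ring.
  by rewrite Ez; ring.
rewrite Ew; apply: prime_factoredM.
  exists 1, [:: q]; rewrite unitr1 big_seq1 mul1r; split=> // x.
  by rewrite inE => /eqP ->.
apply: IHn => //; move: ltpn; rewrite -sp1 Ew size_mul // sq => lt.
have wgt : (0 < size w)%N by rewrite size_poly_gt0.
by lia.
Qed.

End PrimeElements.

(** * Koszul syzygies of a triple *)

Lemma ord3_addE (j : 'I_3) :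
  [/\ j + 1 + 1 = j + 2%:R, j + 1 + 2%:R = j, j + 2%:R + 1 = j
    & j + 2%:R + 2%:R = j + 1].
Proof. by split; apply/val_inj; case: j => [[|[|[|]]]]. Qed.

Lemma ord3P (j l : 'I_3) : [\/ l = j, l = j + 1 | l = j + 2%:R].
Proof.
case: j => [[|[|[|//]]] ?]; case: l => [[|[|[|//]]] ?];
  by [constructor 1; apply/val_inj|constructor 2; apply/val_inj
     |constructor 3; apply/val_inj].
Qed.

Lemma big_ord3 (T : Type) (idx : T) (op : Monoid.com_law idx) (j : 'I_3) F :
  \big[op/idx]_i F i = op (F j) (op (F (j + 1)) (F (j + 2%:R))).
Proof.
rewrite (bigD1 j) //= (bigD1 (j + 1)) /=; last by case: j => [[|[|[|]]]].
rewrite (bigD1 (j + 2%:R)) /=; last by case: j => [[|[|[|]]]].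
rewrite big1 ?Monoid.mulm1 // => i.
by case: j => [[|[|[|//]]] ?]; case: i => [[|[|[|//]]] ?].
Qed.

Section Vectors.
Variable A : comNzRingType.
Implicit Types (a b c e f : 'rV[A]_3) (s t : A).

Definition dot a b : A := \sum_j a 0 j * b 0 j.
Definition cross a b : 'rV[A]_3 :=
  \row_j (a 0 (j + 1) * b 0 (j + 2%:R) - a 0 (j + 2%:R) * b 0 (j + 1)).

Lemma dotE (j : 'I_3) a b : dot a b = a 0 j * b 0 j
  + a 0 (j + 1) * b 0 (j + 1) + a 0 (j + 2%:R) * b 0 (j + 2%:R).
Proof. by rewrite /dot (big_ord3 _ j) /= addrA. Qed.

Lemma dotC a b : dot a b = dot b a.
Proof. by apply: eq_bigr => j _; rewrite mulrC. Qed.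

Lemma dotDl a b c : dot (a + b) c = dot a c + dot b c.
Proof. by rewrite -big_split; apply: eq_bigr => j _; rewrite mxE mulrDl. Qed.

Lemma dotZl s a b : dot (s *: a) b = s * dot a b.
Proof. by rewrite mulr_sumr; apply: eq_bigr => j _; rewrite mxE mulrA. Qed.

Lemma dotNl a b : dot (- a) b = - dot a b.
Proof. by rewrite -scaleN1r dotZl mulN1r. Qed.

Lemma dot0l b : dot 0 b = 0.
Proof. by rewrite -(scale0r b) dotZl mul0r. Qed.

Lemma dot_deltal (j : 'I_3) a : dot (delta_mx 0 j) a = a 0 j.
Proof.
rewrite /dot (bigD1 j) //= mxE !eqxx mul1r big1 ?addr0 // => i /negbTE ij.
by rewrite mxE ij andbF mul0r.
Qed.

Lemma crossDl a b c : cross (a + b) c = cross a c + cross b c.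
Proof. by apply/rowP => j; rewrite !mxE; ring. Qed.

Lemma crossZl s a b : cross (s *: a) b = s *: cross a b.
Proof. by apply/rowP => j; rewrite !mxE; ring. Qed.

Lemma crossZr s a b : cross a (s *: b) = s *: cross a b.
Proof. by apply/rowP => j; rewrite !mxE; ring. Qed.

Lemma crossNl a b : cross (- a) b = - cross a b.
Proof. by apply/rowP => j; rewrite !mxE; ring. Qed.

Lemma crossvv a : cross a a = 0.
Proof. by apply/rowP => j; rewrite !mxE; ring. Qed.

Lemma cross0l a : cross 0 a = 0.
Proof. by apply/rowP => j; rewrite !mxE; ring. Qed.

Lemma cross_suml (I : finType) (F : I -> 'rV[A]_3) a :
  cross (\sum_i F i) a = \sum_i cross (F i) a.
Proof.
elim/big_rec2: _ => [|i x y _ <-]; first exact: cross0l.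
by rewrite crossDl.
Qed.

Lemma cross_cross a b c : cross (cross a b) c = dot a c *: b - dot b c *: a.
Proof.
apply/rowP => j; rewrite !mxE !(dotE j).
by case: (ord3_addE j) => -> -> -> ->; ring.
Qed.

Lemma dot_crossr a b c : dot a (cross b c) = dot (cross a b) c.
Proof.
rewrite !(dotE 0) !mxE; case: (ord3_addE 0) => -> -> -> ->; ring.
Qed.

Lemma dot_crossv a b : dot (cross a b) b = 0.
Proof. by rewrite -dot_crossr crossvv dotC dot0l. Qed.

Lemma cross_delta (j : 'I_3) :
  cross (delta_mx 0 (j + 1)) (delta_mx 0 (j + 2%:R)) = delta_mx 0 j.
Proof.
apply/rowP => i; rewrite !mxE !eqxx /=.
case: j => [[|[|[|//]]] ?]; case: i => [[|[|[|//]]] ?];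
 by rewrite -!val_eqE /= ?mulr0 ?mul0r ?mulr1 ?subr0 ?subrr.
Qed.

(** With three generators the first and second exterior powers are both identified with [A^3], and
    the Koszul differential between them becomes the cross product with [f]. *)
Definition koszul f a : Prop := exists e, a = cross e f.

(* The ideal generated by [f] kills the first Koszul homology.                *)
Lemma koszul_mul w f a : dot a f = 0 -> dot w f *: a = cross (cross w a) f.
Proof. by move=> af; rewrite cross_cross af scale0r subr0. Qed.

Lemma koszulD f a b : koszul f a -> koszul f b -> koszul f (a + b).
Proof. by move=> [e ->] [g ->]; exists (e + g); rewrite crossDl. Qed.

Lemma koszulZ f s a : koszul f a -> koszul f (s *: a).
Proof. by move=> [e ->]; exists (s *: e); rewrite crossZl. Qed.

Definition inideal f x : Prop := exists w, x = dot w f.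

Lemma inideal_ideal f : ideal_pred (inideal f).
Proof.
split; first by exists 0; rewrite dot0l.
  by move=> _ _ [w ->] [v ->]; exists (w + v); rewrite dotDl.
by move=> s _ [w ->]; exists (s *: w); rewrite dotZl.
Qed.

Lemma inideal_gen f j : inideal f (f 0 j).
Proof. by exists (delta_mx 0 j); rewrite dot_deltal. Qed.

End Vectors.

Lemma map_dot (A B : comNzRingType) (g : {rmorphism A -> B}) (a b : 'rV[A]_3) :
  g (dot a b) = dot (map_mx g a) (map_mx g b).
Proof. by rewrite rmorph_sum; apply: eq_bigr => j _; rewrite !mxE rmorphM. Qed.

Lemma map_cross (A B : comNzRingType) (g : {rmorphism A -> B})
    (a b : 'rV[A]_3) :
  map_mx g (cross a b) = cross (map_mx g a) (map_mx g b).
Proof. by apply/rowP => j; rewrite !mxE rmorphB !rmorphM. Qed.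

(** * Syzygies at a point of a chart *)

Lemma row_scaleI (S : idomainType) n (s : S) (a b : 'rV[S]_n) :
  s != 0 -> s *: a = s *: b -> a = b.
Proof.
move=> s0 /rowP E; apply/rowP => j; apply: (mulfI s0).
by have := E j; rewrite !mxE.
Qed.

(** The terms of the Leibniz expansion are congruent modulo [p] factor by factor. *)
Lemma det_perturb (S : comNzRingType) n (X Y : 'M[S]_n) (p : S) :
  dvdr p (\det (X + p *: Y) - \det X).
Proof.
have ip := dvdr_ideal p; rewrite -sumrB; apply: ideal_pred_sum => // s _.
rewrite -mulrBr; apply: (ideal_predM ip).
apply: (big_ind2 (fun x y => dvdr p (x - y))).
- by rewrite subrr; apply: ideal_pred0 ip.
- move=> x1 x2 y1 y2 H1 H2.
  have -> : x1 * y1 - x2 * y2 = y1 * (x1 - x2) + x2 * (y1 - y2) by ring.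
  by apply: (ideal_predD ip); apply: (ideal_predM ip).
- by move=> i _; exists (Y i (s i)); rewrite !mxE; ring.
Qed.

(* Over a domain, this says that the ideal generated by [f] has grade at      *)
(* least two.                                                                 *)
Definition common_divisor_free (S : comNzRingType) (f : 'rV[S]_3) : Prop :=
  forall t s : S, (forall j, dvdr t (s * f 0 j)) -> dvdr t s.

(** * Syzygies of an ideal of grade two *)

Section Grade.
Variables (S : idomainType) (f : 'rV[S]_3).
Hypothesis cdf : common_divisor_free f.

Lemma cdf_ndvd (p : S) : prime_pred (dvdr p) -> exists j, ~ dvdr p (f 0 j).
Proof.
move=> pp; apply: contrapT => /forallNP H; apply: (prime_pred1 pp).
by apply: cdf => j; rewrite mul1r; apply: contrapT; apply: H.
Qed.

Lemma cdf_neq0 : exists j, f 0 j != 0.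
Proof.
apply: contrapT => /forallNP H; have [|c] := @cdf 0 1; last first.
  by move/eqP; rewrite mul0r oner_eq0.
by move=> j; have /negP/negPn/eqP -> := H j; exists 0; rewrite !mulr0.
Qed.

(* Vanishing of the second Koszul homology of [f].                            *)
Lemma cross_eq0 v : cross v f = 0 -> exists w, v = w *: f.
Proof.
move=> vf; have [j0 fj0] := cdf_neq0.
have E j : v 0 j *: f = f 0 j *: v.
  apply/eqP; rewrite -subr_eq0; apply/eqP; have := cross_cross v f (delta_mx 0 j).
  by rewrite vf cross0l !(dotC _ (delta_mx 0 j)) !dot_deltal.
have [j|w Ew] := @cdf (f 0 j0) (v 0 j0).
  by have /rowP/(_ j) := E j0; rewrite !mxE => ->; exists (v 0 j).
by exists w; apply: (row_scaleI fj0); rewrite -E Ew scalerA.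
Qed.

(** Half of Hilbert-Burch: the minors of two syzygies are proportional to [f]. *)
Lemma cross_syz a b : dot a f = 0 -> dot b f = 0 -> exists t, cross a b = t *: f.
Proof. by move=> af bf; apply: cross_eq0; rewrite cross_cross af bf !scale0r subrr. Qed.

Variables (M : S -> Prop) (p : S).
Hypotheses (Mprime : prime_pred M) (Mp : M p) (pprime : prime_elt p).
Hypothesis pid : forall J : S -> Prop, ideal_pred J -> J p ->
  exists2 a, J a & forall x, J x -> exists s t, x = s * a + t * p.

Let p0 : p != 0. Proof. by case: pprime. Qed.
Let pP : prime_pred (dvdr p). Proof. by case: pprime. Qed.

(** Some entry of [f], of index [j], is nonzero modulo [p], so a syzygy modulo [p] is determined by
    its other two entries. As ideals are principal modulo [p], these pairs have a triangular pair of
    generators. *)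
Lemma syz_mod : exists c1 c2, [/\ dot c1 f = 0, dot c2 f = 0 &
  forall n, dot n f = 0 -> exists s t n',
    dot n' f = 0 /\ n = s *: c1 + t *: c2 + p *: n'].
Proof.
have [j nj] := cdf_ndvd pP.
(* Modulo [p], [J1] collects the entries at [j + 1], and [J2] the entries at [j + 2] of the syzygies
   whose entry at [j + 1] vanishes. *)
pose J1 x := exists n y, dot n f = 0 /\ x = n 0 (j + 1) + p * y.
pose J2 x := exists n y z, [/\ dot n f = 0, n 0 (j + 1) = p * z
  & x = n 0 (j + 2%:R) + p * y].
have [||a1 [c1 [y1 [c1f Ea1]]] H1] := @pid J1.
- split; first by exists 0, 0; rewrite dot0l mxE; split=> //; ring.
    move=> _ _ [n [y [nf ->]]] [m [z [mf ->]]]; exists (n + m), (y + z).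
    by rewrite dotDl nf mf addr0 mxE; split=> //; ring.
  move=> s _ [n [y [nf ->]]]; exists (s *: n), (s * y).
  by rewrite dotZl nf mulr0 mxE; split=> //; ring.
- by exists 0, 1; rewrite dot0l mxE; split=> //; ring.
have [||a2 [c2 [y2 [z2 [c2f c2p Ea2]]]] H2] := @pid J2.
- split; first by exists 0, 0, 0; rewrite dot0l !mxE; split=> //; ring.
    move=> _ _ [n [y [u [nf nu ->]]]] [m [z [v [mf mv ->]]]].
    exists (n + m), (y + z), (u + v).
    by rewrite dotDl nf mf addr0 !mxE nu mv; split=> //; ring.
  move=> s _ [n [y [u [nf nu ->]]]]; exists (s *: n), (s * y), (s * u).
  by rewrite dotZl nf mulr0 !mxE nu; split=> //; ring.
- by exists 0, 1, 0; rewrite dot0l !mxE; split=> //; ring.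
exists c1, c2; split=> // n nf.
have [|s [t Es]] := H1 (n 0 (j + 1)); first by exists n, 0; rewrite mulr0 addr0.
pose m := n - s *: c1.
have mf : dot m f = 0 by rewrite dotDl dotNl dotZl nf c1f mulr0 oppr0 addr0.
have m1 : m 0 (j + 1) = p * (s * y1 + t) by rewrite !mxE Es Ea1; ring.
have [|s' [t' Es']] := H2 (m 0 (j + 2%:R)).
  by exists m, 0, (s * y1 + t); rewrite mulr0 addr0.
pose q := m - s' *: c2.
have qf : dot q f = 0 by rewrite dotDl dotNl dotZl mf c2f mulr0 oppr0 addr0.
have q1 : dvdr p (q 0 (j + 1)).
  by exists (s * y1 + t - s' * z2); rewrite [q _ _]mxE m1 !mxE c2p; ring.
have q2 : dvdr p (q 0 (j + 2%:R)).
  by exists (s' * y2 + t'); rewrite [q _ _]mxE Es' !mxE Ea2; ring.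
(* The syzygy equation settles the last entry, since the prime [p] does not divide [f 0 j]. *)
have q0 : dvdr p (q 0 j).
  have : dvdr p (q 0 j * f 0 j).
    have : q 0 j * f 0 j = - (f 0 (j + 1) * q 0 (j + 1))
                           - f 0 (j + 2%:R) * q 0 (j + 2%:R).
      by apply/eqP; rewrite -subr_eq0 -[X in _ == X]qf (dotE j); apply/eqP; ring.
    move=> ->; apply: ideal_predB; first exact: pP.
      by apply: ideal_predN; [exact: pP|apply: ideal_predM; [exact: pP|]].
    by apply: ideal_predM; [exact: pP|].
  by case/(prime_predP pP).
have [w Ew] : exists w, q = p *: w.
  have all i : dvdr p (q 0 i).
    by case: (ord3P j i) => ->.
  have [w Hw] := choice all.
  by exists (\row_i w i); apply/rowP => i; rewrite Hw !mxE.
exists s, s', w; split; last by rewrite -Ew; apply/rowP => i; rewrite !mxE; ring.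
by apply: (mulfI p0); rewrite mulr0 -dotZl -Ew.
Qed.

Variables (r : nat) (h : S).
Hypotheses (fh : inideal f (p ^+ r * h)) (Mh : ~ M h).

(* By [syz_mod], [c1] and [c2] generate the syzygies modulo [p], hence (as    *)
(* [p ^+ r * h] maps syzygies to Koszul ones) the Koszul syzygies up to a     *)
(* multiple outside of [M], by the determinant trick.                         *)
Lemma koszul_gen : exists c1 c2 s, [/\ dot c1 f = 0, dot c2 f = 0, ~ M s &
  forall e, exists a b, s *: cross e f = a *: c1 + b *: c2].
Proof.
have [c1 [c2 [c1f c2f Hc]]] := syz_mod; exists c1, c2.
(* Iterating the reduction replaces [p] by any of its powers. *)
have Hn n m : dot m f = 0 -> exists s t m',
    dot m' f = 0 /\ m = s *: c1 + t *: c2 + p ^+ n *: m'.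
  elim: n m => [|n IHn] m mf.
    by exists 0, 0, m; rewrite !scale0r !add0r expr0 scale1r.
  have [s [t [m1 [/Hc [s' [t' [m2 [m2f ->]]]] ->]]]] := IHn _ mf.
  exists (s + p ^+ n * s'), (t + p ^+ n * t'), m2; split=> //.
  by apply/rowP => j; rewrite !mxE exprSr; ring.
have [w Ew] := fh.
(* With exponent [r.+1], the error term is [p] times a syzygy multiplied by an element of the ideal,
   hence [p] times a Koszul syzygy. *)
have Hh m : dot m f = 0 -> exists s t e,
    h *: m = s *: c1 + t *: c2 + p *: cross e f.
  move=> /(Hn r.+1) [s [t [m' [m'f ->]]]].
  exists (h * s), (h * t), (cross w m'); rewrite -koszul_mul // -Ew.
  by apply/rowP => j; rewrite !mxE exprSr; ring.
have /choice [s /choice [t /choice [e He]]] (l : 'I_3) : exists s t e,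
    h *: cross (delta_mx 0 l) f = s *: c1 + t *: c2 + p *: cross e f.
  by apply: Hh; rewrite dot_crossv.
pose E : 'M[S]_3 := \matrix_l e l.
(* The three relations form a linear system with matrix [X], whose determinant is congruent to
   [h ^+ 3] modulo [p]; the adjugate solves the system up to this determinant. *)
pose X : 'M[S]_3 := h%:M - p *: E.
have crossE (v : 'rV[S]_3) : cross v f = v *m (\matrix_l cross (delta_mx 0 l) f).
  rewrite {1}(row_sum_delta v) cross_suml mulmx_sum_row.
  by apply: eq_bigr => l _; rewrite crossZl rowK.
exists (\det X); split=> //.
  have [z Ez] := det_perturb h%:M (- E) p.
  have -> : \det X = h ^+ 3 + p * z.
    by rewrite -Ez det_scalar scalerN; ring.
  move=> Md; apply: Mh; apply: (prime_predX (n := 3) Mprime).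
  have -> : h ^+ 3 = h ^+ 3 + p * z - z * p by ring.
  by apply: ideal_predB => //; [exact: Mprime|apply: ideal_predM; [exact: Mprime|]].
set F := \matrix_l cross (delta_mx 0 l) f in crossE.
have EXF : X *m F = \matrix_l (s l *: c1 + t l *: c2).
  apply/row_matrixP => l; rewrite mulmxBl mul_scalar_mx -scalemxAl.
  rewrite linearB /= !linearZ /= row_mul !rowK -crossE He.
  by rewrite scalerN addrK.
move=> v; rewrite crossE; pose u := v *m \adj X.
have -> : \det X *: (v *m F) = u *m (X *m F).
  by rewrite mulmxA -(mulmxA v) mul_adj_mx mul_mx_scalar -scalemxAl.
rewrite EXF mulmx_sum_row.
exists (\sum_l u 0 l * s l), (\sum_l u 0 l * t l).
rewrite !scaler_suml -big_split; apply: eq_bigr => l _ /=.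
by rewrite rowK scalerDr !scalerA.
Qed.

Hypothesis fM : forall j, M (f 0 j).
Hypothesis KV : forall a, dot a f = 0 -> (forall j, inideal f (a 0 j)) ->
  koszul f a.

(* If all syzygies had entries in [M], the Koszul syzygies of the unit        *)
(* vectors would be [M]-combinations of syzygies up to a multiple [s] outside *)
(* of [M]; the Koszul complex of the generators [p], [q] of [M] then shows    *)
(* that [s] is in [M].                                                        *)
Theorem syz_unit : exists c j, dot c f = 0 /\ ~ M (c 0 j).
Proof.
apply: contrapT => /forallNP Hc.
have {Hc}NM c j : dot c f = 0 -> M (c 0 j).
  by move=> cf; apply: contrapT => nM; apply: (Hc c); exists j.
have iM : ideal_pred M by exact: Mprime.
(* [M] is generated by [p] and [q]; as [p] does not divide every entry of [f], it does not divide
   [q]. *)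
have [q Mq Hq] := pid iM Mp.
have npq : ~ dvdr p q.
  move=> [y Ey]; have [j] := cdf_ndvd pP; apply.
  have [s [t ->]] := Hq _ (fM j); exists (s * y + t); rewrite Ey; ring.
have [c1 [c2 [s [c1f c2f Ms Hs]]]] := koszul_gen.
have [t Et] := cross_syz c1f c2f.
(* The cross product of two Koszul generators is [f] times an entry of [f]. Expanding it in [c1] and
   [c2] shows that [t] divides [s ^+ 2 * f 0 j] for all [j], hence [s ^+ 2]. *)
have Mt : ~ M t.
  have [j|z Ez] := @cdf t (s ^+ 2); last first.
    by move=> Mt; apply: Ms; apply: (prime_predX (n := 2) Mprime);
       rewrite Ez mulrC; apply: ideal_predM.
  have [a1 [b1 E1]] := Hs (delta_mx 0 (j + 1)).
  have [a2 [b2 E2]] := Hs (delta_mx 0 (j + 2%:R)).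
  exists (a1 * b2 - a2 * b1).
  have [i fi] := cdf_neq0; apply: (mulIf fi).
  have : cross (s *: cross (delta_mx 0 (j + 1)) f)
     (s *: cross (delta_mx 0 (j + 2%:R)) f) = ((a1 * b2 - a2 * b1) * t) *: f.
    rewrite E1 E2 -scalerA -Et.
    by apply/rowP => l; rewrite !mxE; ring.
  rewrite crossZl crossZr cross_cross dot_crossr cross_delta dot_deltal.
  rewrite (dotC f) dot_crossv scale0r subr0.
  by move=> /rowP /(_ i); rewrite !mxE => E; rewrite mulrC [RHS]mulrC; ring: E.
have qM x : M x -> exists u v, x = u * p + v * q.
  by move=> /Hq [u [v ->]]; exists v, u; rewrite addrC.
have /choice [a /choice [b Hab]] (l : 'I_3) : exists a b,
    s *: cross (delta_mx 0 l) f = a *: c1 + b *: c2 by exact: Hs.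
(* Crossing with [c2] gives [a l * t = s * c2 0 l], which lies in [M]; crossing with [c1] treats
   [b l]. *)
have Ma l : M (a l).
  have [i fi] := cdf_neq0.
  have : cross (s *: cross (delta_mx 0 l) f) c2 = (a l * t) *: f.
    rewrite Hab -scalerA -Et.
    by apply/rowP => j; rewrite !mxE; ring.
  rewrite crossZl cross_cross dot_deltal (dotC f) c2f scale0r subr0 scalerA.
  move=> /rowP /(_ i); rewrite !mxE => /(mulIf fi) E.
  have : M (a l * t) by rewrite -E; apply: ideal_predM => //; apply: NM.
  by case/(prime_predP Mprime).
have Mb l : M (b l).
  have [i fi] := cdf_neq0.
  have : cross (s *: cross (delta_mx 0 l) f) c1 = (- b l * t) *: f.
    rewrite Hab -scalerA -Et.
    by apply/rowP => j; rewrite !mxE; ring.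
  rewrite crossZl cross_cross dot_deltal (dotC f) c1f scale0r subr0 scalerA.
  move=> /rowP /(_ i); rewrite !mxE => /(mulIf fi) E.
  have : M (- b l * t) by rewrite -E; apply: ideal_predM => //; apply: NM.
  by case/(prime_predP Mprime) => // /(ideal_predN iM); rewrite opprK.
(* Everything is split along [p] and [q]; then [p *: X l + q *: Y l = 0], and regularity yields
   [X l = q *: G l] and [Y l = - p *: G l]. *)
have /choice [a1 /choice [a2 Ea]] l := qM _ (Ma l).
have /choice [b1 /choice [b2 Eb]] l := qM _ (Mb l).
have /choice [g1 /choice [g2 Eg]] l := qM _ (fM l).
pose f1 : 'rV[S]_3 := \row_l g1 l; pose f2 : 'rV[S]_3 := \row_l g2 l.
have Ef : f = p *: f1 + q *: f2.
  by apply/rowP => l; rewrite !mxE Eg; ring.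
pose X l := a1 l *: c1 + b1 l *: c2 - s *: cross (delta_mx 0 l) f1.
pose Y l := a2 l *: c1 + b2 l *: c2 - s *: cross (delta_mx 0 l) f2.
have XY l : p *: X l + q *: Y l = 0.
  have -> : p *: X l + q *: Y l = (a1 l * p + a2 l * q) *: c1
     + (b1 l * p + b2 l * q) *: c2 - s *: cross (delta_mx 0 l) (p *: f1 + q *: f2).
    by rewrite /X /Y; apply/rowP => j; rewrite !mxE; ring.
  by rewrite -Ea -Eb -Ef Hab subrr.
have /choice [G HG] (l : 'I_3) : exists g, Y l = - p *: g.
  have /choice [w Hw] (j : 'I_3) : dvdr p (Y l 0 j).
    have : dvdr p (q * Y l 0 j).
      exists (- X l 0 j); apply/eqP; rewrite mulrN -subr_eq0 opprK addrC.
      have /rowP /(_ j) := XY l; move: (X l) (Y l) => x y.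
      by rewrite !mxE => ->.
    by case/(prime_predP pP).
  by exists (- \row_j w j); apply/rowP => j; rewrite Hw !mxE; ring.
have HX l : X l = q *: G l.
  apply: (row_scaleI p0); have /eqP := XY l; rewrite HG addr_eq0 => /eqP ->.
  by apply/rowP => j; rewrite !mxE; ring.
(* The syzygy [c] has entries in the ideal by construction, so [KV] makes it Koszul. *)
pose c := \row_l dot (G l) f.
have c1E : q *: c = - s *: cross f1 f.
  apply/rowP => l; rewrite mxE [c _ _]mxE -dotZl -HX /X.
  rewrite dotDl dotNl !dotZl dotDl !dotZl c1f c2f -dot_crossr dot_deltal.
  by rewrite [RHS]mxE; ring.
have c2E : p *: c = s *: cross f2 f.
  apply/rowP => l; rewrite mxE [c _ _]mxE -dotZl.
  rewrite -[p *: _]opprK -scaleNr -HG /Y.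
  rewrite dotNl dotDl dotNl !dotZl dotDl !dotZl c1f c2f -dot_crossr dot_deltal.
  by rewrite [RHS]mxE; ring.
have cf : dot c f = 0.
  by apply: (mulfI p0); rewrite mulr0 -dotZl c2E dotZl dot_crossv mulr0.
have [|e Ee] := KV cf; first by move=> j; exists (G j); rewrite mxE.
(* Both combinations have zero cross product with [f], hence are multiples of [f]; eliminating [e]
   between them writes [s] through [p] and [q]. *)
have [|t1 E1] := @cross_eq0 (q *: e + s *: f1).
  by rewrite crossDl !crossZl -Ee c1E scaleNr addNr.
have [|t2 E2] := @cross_eq0 (p *: e - s *: f2).
  by rewrite crossDl crossNl !crossZl -Ee c2E subrr.
have [i fi] := cdf_neq0.
have Es : s = t1 * p - t2 * q.
  apply: (mulIf fi).
  have -> : (t1 * p - t2 * q) * f 0 i = (p *: (t1 *: f) - q *: (t2 *: f)) 0 i.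
    by rewrite !mxE; ring.
  by rewrite -E1 -E2 {1}Ef !mxE; ring.
apply: Ms; rewrite Es; apply: ideal_predB => //; exact: ideal_predM.
Qed.

End Grade.

(** * Ideals of a polynomial ring modulo a prime of the base *)

Section PolyModPrime.
Variables (D : idomainType) (p : D).
Hypothesis inv_mod : forall c : D, ~ dvdr p c -> exists u v, u * c = 1 + v * p.

(** Leading terms divisible by [p] are dropped; the first one that is not is made monic by an
    inverse modulo [p] and a correction by a multiple of [p]. *)
Lemma monic_mod (J : {poly D} -> Prop) (x : {poly D}) :
  ideal_pred J -> J p%:P -> J x -> ~ dvdr p%:P x ->
  exists a, [/\ J a, a \is monic & (size a <= size x)%N].
Proof.
move=> iJ Jp; have [n] := ubnP (size x); elim: n x => // n IHn x ltxn Jx npx.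
have x0 : x != 0.
  by apply: contra_notN npx => /eqP ->; exists 0; rewrite mulr0.
have sx : size x = (size x).-1.+1 by rewrite prednK // size_poly_gt0.
set m := (size x).-1 in sx.
have [[d Ed]|npl] := pselect (dvdr p (lead_coef x)).
  pose y := x - (lead_coef x *: 'X^m).
  have Ely : lead_coef x *: 'X^m = (d *: 'X^m) * p%:P.
    by rewrite Ed -!mul_polyC polyCM; ring.
  have lesy : (size y <= m)%N.
    apply/leq_sizeP => j; rewrite leq_eqVlt => /predU1P [<-|ltmj].
      by rewrite !coefE eqxx mulr1 lead_coefE subrr.
    by rewrite !coefE gtn_eqF // mulr0 subr0 nth_default // sx.
  have [|||a [Ja mona lesa]] := IHn y.
  - by rewrite -ltnS (leq_trans _ ltxn) // ltnS sx.
  - by apply: ideal_predB => //; rewrite Ely; apply: ideal_predM.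
  - move=> [w Ew]; apply: npx; exists (w + d *: 'X^m).
    by rewrite mulrDr -Ew [p%:P * (_ *: _)]mulrC -Ely subrK.
  exists a; split=> //; apply: (leq_trans lesa); apply: (leq_trans lesy).
  by rewrite sx.
have [u [v Euv]] := inv_mod npl.
pose a := u *: x - (v * p) *: 'X^m.
have am : a`_m = 1.
  by rewrite !coefE eqxx mulr1 -lead_coefE Euv addrK.
have lesa : (size a <= m.+1)%N.
  apply/leq_sizeP => j ltmj; rewrite !coefE gtn_eqF // mulr0 subr0.
  by rewrite nth_default ?mulr0 // sx.
have sa : size a = m.+1.
  apply/eqP; rewrite eqn_leq lesa ltnNge; apply/negP => /leq_sizeP /(_ _ (leqnn m)).
  by rewrite am => /eqP; rewrite oner_eq0.
exists a; split; last by rewrite sx.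
  apply: ideal_predB => //; first by rewrite -mul_polyC; apply: ideal_predM.
  have -> : (v * p) *: 'X^m = (v *: 'X^m) * p%:P.
    by rewrite -!mul_polyC polyCM; ring.
  exact: ideal_predM.
by rewrite monicE lead_coefE sa am.
Qed.

(** Euclidean division by a monic element of least size in [J]: a remainder not divisible by [p]
    would yield a smaller one. *)
Lemma ideal_mod_principal (J : {poly D} -> Prop) : ideal_pred J -> J p%:P ->
  exists2 a, J a & forall x, J x -> exists s t, x = s * a + t * p%:P.
Proof.
move=> iJ Jp; have [allp|] := pselect (forall x, J x -> dvdr p%:P x).
  exists 0 => [|x /allp [t ->]]; first exact: ideal_pred0.
  by exists 0, t; ring.
move=> /existsNP [x0 /not_implyP [Jx0 npx0]].
have [a0 [Ja0 mona0 _]] := monic_mod iJ Jp Jx0 npx0.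
have exa : exists n, `[< exists a : {poly D}, [/\ J a, a \is monic & size a = n] >].
  by exists (size a0); apply/asboolP; exists a0.
case: (ex_minnP exa) => n /asboolP [a [Ja mona sa]] minn.
exists a => // x Jx.
have Ex := Pdiv.RingMonic.rdivp_eq mona x.
set q := Pdiv.CommonRing.rdivp x a in Ex; set r := Pdiv.CommonRing.rmodp x a in Ex.
have Jr : J r.
  have -> : r = x - q * a by rewrite Ex addrC addKr.
  by apply: ideal_predB => //; apply: ideal_predM.
have [[t Et]|npr] := pselect (dvdr p%:P r).
  by exists q, t; rewrite {1}Ex Et [_ * t]mulrC.
have [b [Jb monb lesb]] := monic_mod iJ Jp Jr npr.
have : (n <= size b)%N by apply: minn; apply/asboolP; exists b.
rewrite leqNgt => /negP []; rewrite (leq_ltn_trans lesb) // -sa.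
by rewrite Pdiv.CommonRing.ltn_rmodpN0 ?monic_neq0.
Qed.

End PolyModPrime.

(** The gcd of [p] and [c] divides the prime [p] without being associate to it, so it is a unit and
    Bezout applies. *)
Lemma prime_poly_inv_mod (k : fieldType) (p c : {poly k}) : prime_elt p ->
  ~ dvdr p c -> exists u v, u * c = 1 + v * p.
Proof.
move=> [p0 pP] npc; suff: coprimep p c.
  case/Bezout_eq1_coprimepP => -[u v] /= E; exists v, (- u).
  by rewrite -E; ring.
have [w Ew] := dvdpP _ _ (dvdp_gcdl p c); have [w' Ew'] := dvdpP _ _ (dvdp_gcdr p c).
have : dvdr p (w * gcdp p c) by exists 1; rewrite -Ew mulr1.
case/(prime_predP pP) => [[y Ey]|[y Ey]].
  rewrite /coprimep; have g0 : gcdp p c != 0 by rewrite gcdp_eq0 negb_and p0.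
  have : y * gcdp p c = 1.
    by apply: (mulfI p0); rewrite mulr1 mulrA -Ey -Ew.
  by move=> yg1; rewrite -dvdp1; apply/dvdpP; exists y.
by case: npc; exists (w' * y); rewrite Ew' {1}Ey; ring.
Qed.

(** * Elimination of a variable *)

Section BivariateElimination.
Variable D : idomainType.

Lemma ideal_gcdp (J : {poly D} -> Prop) (a b : {poly D}) : ideal_pred J ->
  (exists2 c, c != 0 & J (c *: a)) -> (exists2 c, c != 0 & J (c *: b)) ->
  exists2 c, c != 0 & J (c *: gcdp a b).
Proof.
move=> iJ [c c0 Jc] [d d0 Jd].
have [[u v] /= /Pdiv.Idomain.eqpP [[c1 c2] /= /andP [c10 c20] E]] :=
  Pdiv.Idomain.Bezoutp a b.
exists (c * d * c2); first by rewrite !mulf_neq0.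
have -> : (c * d * c2) *: gcdp a b =
    (d * c1)%:P * u * (c *: a) + (c * c1)%:P * v * (d *: b).
  by rewrite -scalerA -E -!mul_polyC !polyCM; ring.
by apply: ideal_predD => //; apply: ideal_predM.
Qed.

(** The gcd [g] over the fraction field lies in the ideal up to a constant and divides constant
    multiples of all entries; by the hypothesis on common divisors it divides a constant, hence is
    one. *)
Lemma cdf_elimination (f : 'rV[{poly D}]_3) : common_divisor_free f ->
  exists2 h : D, h != 0 & inideal f h%:P.
Proof.
move=> cdf; pose j0 : 'I_3 := 0; pose j1 : 'I_3 := 1; pose j2 : 'I_3 := 2%:R.
pose g := gcdp (f 0 j0) (gcdp (f 0 j1) (f 0 j2)).
have [c c0 Jc] : exists2 c, c != 0 & inideal f (c *: g).
  have gen j : exists2 c, c != 0 & inideal f (c *: f 0 j).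
    by exists 1; rewrite ?oner_eq0 ?scale1r //; apply: inideal_gen.
  by do 2! [apply: ideal_gcdp; [exact: inideal_ideal|exact: gen|]]; apply: gen.
have /choice [d Hd] j : exists d, d != 0 /\ dvdr g (d *: f 0 j).
  have /Pdiv.Idomain.dvdpP [[d w] /= d0 E] : g %| f 0 j; last first.
    by exists d; split=> //; exists w; rewrite E mulrC.
  have g1 : g %| f 0 j1 by rewrite (dvdp_trans (dvdp_gcdr _ _)) ?dvdp_gcdl.
  have g2 : g %| f 0 j2 by rewrite (dvdp_trans (dvdp_gcdr _ _)) ?dvdp_gcdr.
  case: j => [[|[|[|//]]] ltj].
  - by rewrite (_ : Ordinal ltj = j0) ?dvdp_gcdl //; apply/val_inj.
  - by rewrite (_ : Ordinal ltj = j1) //; apply/val_inj.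
  - by rewrite (_ : Ordinal ltj = j2) //; apply/val_inj.
pose C := \prod_j d j.
have C0 : C != 0 by apply/prodf_neq0 => j _; case: (Hd j).
have /dvdr_polyP [w Ew] : dvdr g C%:P.
  apply: cdf => j; rewrite /C (bigD1 j) //= polyCM mulrC mulrA [f 0 j * _]mulrC.
  rewrite mul_polyC mulrC; apply: ideal_predM; first exact: dvdr_ideal.
  by case: (Hd j).
have [g0 w0] : g != 0 /\ w != 0.
  by apply/andP; rewrite -negb_or -mulf_eq0 -Ew polyC_eq0.
have Eg : g = (g`_0)%:P.
  apply: size1_polyC; have := size_mul g0 w0; rewrite -Ew size_polyC C0.
  have : (0 < size w)%N by rewrite size_poly_gt0.
  by lia.
exists (c * g`_0); first by rewrite mulf_neq0 // -polyC_eq0 -Eg.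
by rewrite polyCM -Eg mul_polyC.
Qed.
End BivariateElimination.

(** * Primes of a chart above the ideal *)

Section ChartSyzygies.
Variables (k : fieldType) (f : 'rV[{poly {poly k}}]_3).
Variable M : {poly {poly k}} -> Prop.
Hypotheses (cdf : common_divisor_free f) (Mprime : prime_pred M).

Hypothesis fM : forall j, M (f 0 j).

(** The trace of [M] on [k[s]] is nonzero by elimination and generated by its element [p] of least
    size; factors [p] are removed from the eliminant until the cofactor [h] leaves [M]. *)
Lemma chart_prime : exists (p : {poly k}) r h,
  [/\ prime_elt p, M p%:P, inideal f (p%:P ^+ r * h%:P) & ~ M h%:P].
Proof.
have [h0 h00 fh0] := cdf_elimination cdf.
have iM : ideal_pred M by exact: Mprime.
have Mf x : inideal f x -> M x.
  by move=> [w ->]; apply: ideal_pred_sum => // j _; apply: ideal_predM.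
have exp : exists n, `[< exists p : {poly k}, [/\ p != 0, M p%:P & size p = n] >].
  by exists (size h0); apply/asboolP; exists h0; split=> //; apply: Mf.
case: (ex_minnP exp) => n /asboolP [p [p0 Mp sp]] minn.
have pM x : M x%:P <-> dvdr p x.
  split=> [Mx|[w ->]]; last by rewrite polyCM mulrC; apply: ideal_predM.
  exists (x %/ p); rewrite mulrC {1}(divp_eq x p).
  suff -> : x %% p = 0 by rewrite addr0.
  apply/eqP/negP => /negP r0; have : (n <= size (x %% p)%R)%N.
    apply: minn; apply/asboolP; exists (x %% p); split=> //.
    have -> : x %% p = x - (x %/ p) * p by rewrite {2}(divp_eq x p) addrC addKr.
    by rewrite polyCB polyCM; apply: ideal_predB => //; apply: ideal_predM.
  by rewrite leqNgt -sp ltn_modp p0.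
have pp : prime_elt p.
  split=> //; split; first exact: dvdr_ideal.
    by move/pM; rewrite polyC1; apply: prime_pred1.
  move=> a b /pM; rewrite polyCM => /(prime_predP Mprime).
  by case=> /pM; [left|right].
exists p; have sp1 : (1 < size p)%N.
  rewrite ltnNge; apply/negP => /size1_polyC E.
  have a0 : p`_0 != 0 by rewrite -polyC_eq0 -E.
  case: pp => _ /prime_pred1; apply; exists (p`_0)^-1%:P.
  by rewrite {1}E -polyCM mulfV.
have {fh0} fh0 : inideal f (p%:P ^+ 0 * h0%:P) by rewrite expr0 mul1r.
move: {exp} 0%N fh0; have [m] := ubnP (size h0).
elim: m h0 h00 => // m IHm h h0 lth r fh.
have [Mh|nMh] := pselect (M h%:P); last by exists r, h.
have [w Ew] := dvdr_polyP ((pM h).1 Mh).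
have w0 : w != 0 by apply: contraNneq h0 => z; rewrite Ew z mulr0.
apply: (IHm w w0 _ r.+1); last by rewrite exprSr -mulrA -polyCM -Ew.
by have := size_mul p0 w0; rewrite -Ew sp; move: lth; rewrite sp in sp1; lia.
Qed.

Hypothesis KV : forall a, dot a f = 0 -> (forall j, inideal f (a 0 j)) ->
  koszul f a.

Lemma chart_syz_unit : exists c j, dot c f = 0 /\ ~ M (c 0 j).
Proof.
have [p [r [h [pp Mp fh Mh]]]] := chart_prime.
apply: (@syz_unit _ f cdf M p%:P Mprime Mp _ _ r h%:P) => //.
  exact: prime_elt_polyC.
by move=> J; apply: ideal_mod_principal => c; apply: prime_poly_inv_mod.
Qed.

End ChartSyzygies.

(** * The polynomial ring in three variables *)

Section PolyExt.
Variables (A B : comNzRingType) (g : {rmorphism A -> B}) (x : B).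

Definition poly_ext : {rmorphism {poly A} -> B} :=
  GRing.RMorphism.clone _ _ (horner_eval x \o map_poly g) _.

Lemma poly_extC a : poly_ext a%:P = g a.
Proof. by rewrite /poly_ext /= map_polyC /= /horner_eval hornerC. Qed.

Lemma poly_extX : poly_ext 'X = x.
Proof. by rewrite /poly_ext /= map_polyX /horner_eval hornerX. Qed.

End PolyExt.

Lemma mpoly_rmorph_ext (k : comNzRingType) n (B : comNzRingType)
    (g h : {rmorphism {mpoly k[n]} -> B}) :
  (forall c : k, g c%:MP = h c%:MP) -> (forall i, g 'X_i = h 'X_i) -> g =1 h.
Proof.
move=> EC EX F; rewrite (mpolyE F) !rmorph_sum; apply: eq_bigr => m _.
rewrite -mul_mpolyC !rmorphM EC; congr (_ * _).
by rewrite mpolyXE_id !rmorph_prod; apply: eq_bigr => i _; rewrite !rmorphXn EX.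
Qed.

Lemma rmorph_poly_surj (A : comNzRingType) (B : comNzRingType)
    (g : {rmorphism B -> {poly A}}) :
  (forall a, exists b, g b = a%:P) -> (exists b, g b = 'X) ->
  forall p, exists b, g b = p.
Proof.
move=> HC [x HX]; elim/poly_ind => [|p c [b Hb]]; first by exists 0; rewrite rmorph0.
by have [a Ha] := HC c; exists (b * x + a); rewrite rmorphD rmorphM Hb HX Ha.
Qed.

Lemma factorial_ring_bij (A B : idomainType) (g : {rmorphism A -> B})
    (h : {rmorphism B -> A}) :
  cancel g h -> cancel h g -> factorial_ring A -> factorial_ring B.
Proof.
move=> gK hK fA b b0; have a0 : h b != 0 by rewrite -(rmorph0 h) (inj_eq (can_inj hK)).
have dvdrE x y : dvdr (g x) y <-> dvdr x (h y).
  split=> [[w ->]|[w Ew]]; first by exists (h w); rewrite rmorphM gK.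
  by exists (g w); rewrite -rmorphM -Ew hK.
have [u [s [Uu ps E]]] := fA _ a0; exists (g u), (map g s); split.
- exact: rmorph_unit.
- move=> _ /mapP [q /ps [q0 pq] ->]; split.
    by rewrite -(rmorph0 g) (inj_eq (can_inj gK)).
  split; first exact: dvdr_ideal.
    by move/dvdrE; rewrite rmorph1; apply: prime_pred1 pq.
  move=> x y /dvdrE; rewrite rmorphM => /(prime_predP pq).
  by case=> H; [left|right]; apply/dvdrE.
- by rewrite big_map -rmorph_prod -rmorphM -E hK.
Qed.

Section FactorialMpoly.
Variable k : fieldType.
Local Notation R := {mpoly k[3]}.
Local Notation P3 := {poly {poly {poly k}}}.

Definition polyC3 : {rmorphism k -> P3} :=
  GRing.RMorphism.clone _ _
    ((@polyC {poly {poly k}} : {rmorphism _ -> _}) \o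
     ((@polyC {poly k} : {rmorphism _ -> _}) \o (@polyC k : {rmorphism _ -> _}))) _.

Definition polyX3 (i : 'I_3) : P3 := tnth [tuple ('X%:P)%:P; 'X%:P; 'X] i.

Definition poly_of_mpoly : {rmorphism R -> P3} :=
  GRing.RMorphism.clone _ _ (mmap polyC3 polyX3) _.

Definition mpoly_of_poly : {rmorphism P3 -> R} :=
  poly_ext (poly_ext (poly_ext (mpolyC 3 (R := k)) 'X_0) 'X_1) 'X_2%:R.

Lemma poly_of_mpolyC c : poly_of_mpoly c%:MP = c%:P%:P%:P.
Proof. by rewrite /poly_of_mpoly /= mmapC. Qed.

Lemma poly_of_mpolyX i : poly_of_mpoly 'X_i = polyX3 i.
Proof. by rewrite /poly_of_mpoly /= mmapX mmap1U. Qed.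

Lemma poly_of_mpolyK : cancel poly_of_mpoly mpoly_of_poly.
Proof.
move=> F; have := @mpoly_rmorph_ext k 3 R
  (GRing.RMorphism.clone _ _ (mpoly_of_poly \o poly_of_mpoly) _) idfun.
apply=> [c|i]; rewrite -[LHS]/(mpoly_of_poly (poly_of_mpoly _)).
  by rewrite poly_of_mpolyC /mpoly_of_poly !poly_extC.
rewrite poly_of_mpolyX; case: i => [[|[|[|//]]] lti].
- rewrite [polyX3 _]/(('X%:P)%:P) /mpoly_of_poly !poly_extC poly_extX.
  by congr 'X_(_); apply/val_inj.
- rewrite [polyX3 _]/('X%:P) /mpoly_of_poly poly_extC poly_extX.
  by congr 'X_(_); apply/val_inj.
- rewrite [polyX3 _]/('X) /mpoly_of_poly poly_extX.
  by congr 'X_(_); apply/val_inj.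
Qed.

Lemma mpoly_of_polyK : cancel mpoly_of_poly poly_of_mpoly.
Proof.
suff surj q : exists F, poly_of_mpoly F = q.
  by move=> q; have [F <-] := surj q; rewrite poly_of_mpolyK.
have HX (i : 'I_3) : exists F, poly_of_mpoly F = polyX3 i.
  by exists 'X_i; rewrite poly_of_mpolyX.
move: q; apply: rmorph_poly_surj; last exact: (HX 2%:R).
elim/poly_ind => [|p c [F HF]]; first by exists 0; rewrite rmorph0 polyC0.
have [G HG] : exists G, poly_of_mpoly G = c%:P%:P; last first.
  have [x Hx] := HX 1; exists (F * x + G).
  by rewrite rmorphD rmorphM HF Hx HG /= polyCD polyCM.
elim/poly_ind: c => [|q d [G HG]]; first by exists 0; rewrite rmorph0 !polyC0.
have [x Hx] := HX 0; exists (G * x + d%:MP).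
by rewrite rmorphD rmorphM HG Hx poly_of_mpolyC /= !polyCD !polyCM.
Qed.

Lemma factorial_mpoly3 : factorial_ring R.
Proof.
apply: (factorial_ring_bij mpoly_of_polyK poly_of_mpolyK).
by do 3! apply: factorial_poly; apply: factorial_field.
Qed.

End FactorialMpoly.

Lemma prime_pred_idealr (A : comNzRingType) (P : A -> Prop) : prime_pred P ->
  exists Q : prime_idealr A, forall x, x \in Q <-> P x.
Proof.
move=> pP; pose S : {pred A} := fun x => `[< P x >].
have SE x : x \in S <-> P x by split=> [/asboolP|?] //; apply/asboolP.
have iS : idealr_closed S.
  split; first by apply/SE; apply: ideal_pred0 pP.
    by apply/negP => /SE; apply: prime_pred1 pP.
  move=> a x y /SE Px /SE Py; apply/SE.
  by apply: (ideal_predD pP) => //; apply: (ideal_predM pP).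
have pS : prime_idealr_closed S.
  by move=> x y /SE /(prime_predP pP) [] H; apply/orP; [left|right]; apply/SE.
pose Z := GRing.isZmodClosed.Build _ S (idealr_closedB iS).
pose I := isProperIdeal.Build _ S (idealr_closed_nontrivial iS).
pose C := isPrimeIdealrClosed.Build _ S pS.
by exists (HB.pack_for (prime_idealr A) S Z I C).
Qed.

(** * Primes of height at most one *)

Section Height.
Variables (k : fieldType) (n : nat).
Local Notation R := {mpoly k[n]}.

Lemma prime_elt_msize (q : R) : prime_elt q -> (1 < msize q)%N.
Proof.
move=> [q0 pq]; rewrite ltnNge; apply/negP => /msize1_polyC E.
apply: (prime_pred1 pq); exists (q@_0)^-1%:MP.
rewrite {1}E -mpolyCM mulfV //.
by apply: contraNneq q0 => z; rewrite E z mpolyC0.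
Qed.

(** If a nonzero prime lay strictly inside the one generated by [q], its nonzero elements could be
    divided by [q] within it forever, with ever smaller size. *)
Lemma not_height_ge2 (P : prime_idealr R) (q : R) :
  q = 0 \/ prime_elt q -> (forall x, x \in P <-> dvdr q x) -> ~ height_ge P 2.
Proof.
move=> Hq HP [c [cS c2]].
have memc2 x : x \in c 2%N <-> dvdr q x.
  by rewrite -HP; split=> Hx; have := c2; rewrite predeqE => /(_ x) [H1 H2]; [apply: H1|apply: H2].
have := cS 0%N isT; rewrite properEneq => -[/eqP ne01 s01].
have := cS 1%N isT; rewrite properEneq => -[/eqP ne12 s12].
have [u cu u0] : exists2 u, u \in c 1%N & u != 0.
  apply: contrapT => H; apply: ne01; apply/seteqP; split=> // x /= cx.
  suff -> : x = 0 by apply: rpred0.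
  by apply/eqP/negP => /negP x0; apply: H; exists x.
case: Hq => [q0|pq].
  have /memc2 [w Ew] : u \in c 2%N by apply: s12.
  by move: u0; rewrite Ew q0 mul0r eqxx.
have nq : q \notin c 1%N.
  apply/negP => cq; apply: ne12; apply/seteqP; split=> // x /= /memc2 [w ->].
  by rewrite mulrC; apply: idealMr.
have [m] := ubnP (msize u); elim: m u cu u0 => // m IHm u cu u0 ltm.
have /memc2 [w Ew] : u \in c 2%N by apply: s12.
have w0 : w != 0 by apply: contraNneq u0 => z; rewrite Ew z mulr0.
have cw : w \in c 1%N.
  by move: cu; rewrite Ew prime_idealrM (negbTE nq).
apply: (IHm w cw w0).
have q0 : q != 0 by case: pq.
have : msize w != 0%N by rewrite msize_poly_eq0.
move: ltm (prime_elt_msize pq); rewrite Ew msizeM //.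
by move: (msize q) (msize w) => a b; lia.
Qed.
End Height.

Definition codim_ge2 (k : fieldType) n (F : 'rV[{mpoly k[n]}]_3) : Prop :=
  forall P : prime_idealr {mpoly k[n]},
    (forall j, F 0 j \in P) -> height_ge P 2.

(** A prime element dividing all entries would generate a prime ideal of height at most one
    containing them; so the prime factors of [t] can be divided out of [s] one by one. *)
Lemma codim_cdf (k : fieldType) (F : 'rV[{mpoly k[3]}]_3) :
  codim_ge2 F -> common_divisor_free F.
Proof.
move=> codimF.
have noq q : q = 0 \/ prime_elt q -> exists j, ~ dvdr q (F 0 j).
  move=> Hq; apply: contrapT => /forallNP H.
  have pq : prime_pred (dvdr q).
    case: Hq => [->|[]//]; split; first exact: dvdr_ideal.
      by move=> [c /eqP]; rewrite mul0r oner_eq0.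
    move=> a b [c /eqP]; rewrite mul0r mulf_eq0.
    by case/orP => /eqP ->; [left|right]; exists 0; rewrite mulr0.
  have [P HP] := prime_pred_idealr pq.
  apply: (not_height_ge2 Hq HP); apply: codimF => j.
  by apply/HP; apply: contrapT; apply: H.
(* For [t = 0], some entry is nonzero because the zero ideal has height below two. *)
move=> t s; have [-> H|t0] := eqVneq t 0.
  have [j Fj] := noq 0 (or_introl erefl); exists 0; rewrite mulr0.
  have [w /eqP] := H j; rewrite mul0r mulf_eq0 => /orP [/eqP ->//|/eqP z].
  by case: Fj; exists 0; rewrite z mulr0.
have [u [l [Uu pl ->]]] := factorial_mpoly3 t0.
elim: l s pl => [|q l IHl] s pl H.
  by rewrite big_nil mulr1; exists (u^-1 * s); rewrite mulrA mulrV ?mul1r.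
have pq : prime_elt q by apply: pl; rewrite mem_head.
have [q0 qP] := pq; have [j Fj] := noq q (or_intror pq).
have [s' Es] : dvdr q s.
  have : dvdr q (s * F 0 j).
    by have [w ->] := H j; exists (u * (\prod_(i <- l) i) * w); rewrite big_cons; ring.
  by case/(prime_predP qP).
have [||w Ew] := IHl s'.
- by move=> x xl; apply: pl; rewrite inE xl orbT.
- move=> i; have [w Ew] := H i; exists w; apply: (mulfI q0).
  by rewrite mulrA -Es Ew big_cons; ring.
by exists w; rewrite Es Ew big_cons; ring.
Qed.

(** * Powers of the variables form a regular sequence *)

Section Monomials.
Variables (k : comNzRingType) (n : nat).
Local Notation R := {mpoly k[n]}.
Implicit Types (i l : 'I_n) (t : R) (N : nat).

Lemma mcoeffXnM_lt i N t (m : 'X_{1..n}) : (m i < N)%N -> ('X_i ^+ N * t)@_m = 0.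
Proof.
move=> ltmN; apply/memN_msupp_eq0; rewrite mulrC mpolyXn (perm_mem (msuppMX _ _)).
apply/negP => /mapP [m' _ Em]; move: ltmN.
by rewrite Em mnmDE mulmnE mnmE eqxx mul1n ltnNge leq_addr.
Qed.

Lemma mcoeffXnM_add i N t (m : 'X_{1..n}) :
  ('X_i ^+ N * t)@_(U_(i) *+ N + m) = t@_m.
Proof. by rewrite mulrC mpolyXn mcoeffMX. Qed.

Lemma split_Xn i N t : exists a r, t = 'X_i ^+ N * a + r /\
  forall m : 'X_{1..n}, r@_m = if (N <= m i)%N then 0 else t@_m.
Proof.
pose P (m : 'X_{1..n}) := (N <= m i)%N.
exists (\sum_(m <- msupp t | P m) t@_m *: 'X_[m - U_(i) *+ N]).
exists (\sum_(m <- msupp t | ~~ P m) t@_m *: 'X_[m]); split.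
  rewrite {1}(mpolyE t) (bigID P) /=; congr (_ + _).
  rewrite mulr_sumr; apply: eq_bigr => m Pm.
  rewrite -scalerAr mpolyXn -mpolyXD addmC submK //.
  apply/mnm_lepP => j; rewrite mulmnE mnmE.
  by case: eqP => [<-|//]; rewrite mul1n.
move=> m; rewrite raddf_sum /= -/(P m).
have [Pm|nPm] := ifPn.
  rewrite big1 // => m' nPm'; rewrite mcoeffZ mcoeffX.
  by case: eqP => [E|]; [rewrite E Pm in nPm'|rewrite mulr0].
rewrite [in RHS](mpolyE t) raddf_sum /= [RHS](bigID P) /= [X in _ = X + _]big1 ?add0r //.
move=> m' Pm'; rewrite mcoeffZ mcoeffX.
by case: eqP => [E|]; [rewrite -E Pm' in nPm|rewrite mulr0].
Qed.

Lemma dvdr_Xn i N t : (forall m : 'X_{1..n}, (m i < N)%N -> t@_m = 0) ->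
  dvdr ('X_i ^+ N) t.
Proof.
move=> H; have [a [r [E Hr]]] := split_Xn i N t; exists a; rewrite {1}E.
suff -> : r = 0 by rewrite addr0.
by apply/mpolyP => m; rewrite Hr mcoeff0; case: leqP => // /H.
Qed.

Lemma dvdr_Xn_mul i l N t : i != l -> dvdr ('X_i ^+ N) ('X_l ^+ N * t) ->
  dvdr ('X_i ^+ N) t.
Proof.
move=> il [w E]; apply: dvdr_Xn => m ltmN.
rewrite -(mcoeffXnM_add l N) E mcoeffXnM_lt //.
by rewrite mnmDE mulmnE mnmE eq_sym (negbTE il) mul0n.
Qed.

(** Let [r] be [tl] reduced modulo ['X_i ^+ N]. Multiplied by ['X_l ^+ N], a monomial of [r] whose
    exponent at [j] is below [N] cannot cancel against the other two terms. *)
Lemma Xn_regular i j l N (ti tj tl : R) : i != l -> j != l ->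
  'X_l ^+ N * tl + 'X_j ^+ N * tj + 'X_i ^+ N * ti = 0 ->
  exists a b, tl = 'X_i ^+ N * a + 'X_j ^+ N * b.
Proof.
move=> il jl E; have [a [r [Er Hr]]] := split_Xn i N tl.
suff [b Eb] : dvdr ('X_j ^+ N) r by exists a, b; rewrite Er Eb.
apply: dvdr_Xn => m ltmj; rewrite Hr; case: leqP => // ltmi.
have := congr1 (mcoeff (U_(l) *+ N + m)) E.
rewrite !mcoeffD mcoeffXnM_add !mcoeffXnM_lt ?mcoeff0 ?addr0 //.
  by rewrite mnmDE mulmnE mnmE eq_sym (negbTE il) mul0n.
by rewrite mnmDE mulmnE mnmE eq_sym (negbTE jl) mul0n.
Qed.

End Monomials.

(* The Koszul syzygies are a second syzygy module, hence have depth at least  *)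
(* two; this is the Cech complex of [x], [y], [z] made explicit.              *)
Lemma koszul_depth (S : idomainType) (f a : 'rV[S]_3) (x y z : S) :
  common_divisor_free f -> x != 0 ->
  (forall t, dvdr x (y * t) -> dvdr x t) ->
  (forall tx ty tz, z * tz + y * ty + x * tx = 0 ->
     exists u v, tz = x * u + y * v) ->
  koszul f (x *: a) -> koszul f (y *: a) -> koszul f (z *: a) -> koszul f a.
Proof.
move=> cdf x0 regxy regxyz [ex Ex] [ey Ey] [ez Ez].
(* Preimages of two multiples of [a], cross-multiplied, differ by a multiple of [f], since the
   second Koszul homology vanishes. *)
have Ht s t es et : s *: a = cross es f -> t *: a = cross et f ->
    exists w, t *: es - s *: et = w *: f.
  move=> Es Et; apply: (cross_eq0 cdf).
  by rewrite crossDl crossNl !crossZl -Es -Et !scalerA mulrC subrr.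
have [tz Etz] := Ht _ _ _ _ Ex Ey; have [ty Ety] := Ht _ _ _ _ Ez Ex.
have [tx Etx] := Ht _ _ _ _ Ey Ez; have [j fj] := cdf_neq0 cdf.
(* The three multipliers satisfy the cocycle relation, which regularity solves for [tz]. *)
have [|u [v Euv]] := regxyz tx ty tz.
  apply: (mulIf fj); rewrite mul0r.
  transitivity ((z *: (tz *: f) + y *: (ty *: f) + x *: (tx *: f)) 0 j).
    by rewrite !mxE; ring.
  by rewrite -Etz -Ety -Etx !mxE; ring.
(* Corrected by [v *: f], the preimage [ex] becomes divisible by [x]; the quotient is a preimage of
   [a]. *)
have /choice [g Hg] (l : 'I_3) : dvdr x ((ex - v *: f) 0 l).
  apply: regxy; exists ((ey + u *: f) 0 l).
  move/rowP/(_ l): Etz; rewrite Euv !mxE => E.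
  by apply/eqP; rewrite -subr_eq0; apply/eqP; rewrite -(subrr (y * ex 0 l - x * ey 0 l)) {2}E; ring.
exists (\row_l g l); apply: (row_scaleI x0); rewrite Ex -crossZl.
have -> : x *: (\row_l g l) = ex - v *: f by apply/rowP => l; rewrite Hg !mxE.
by rewrite crossDl crossNl crossZl crossvv scaler0 subr0.
Qed.

Lemma koszul_saturated (k : fieldType) (F a : 'rV[{mpoly k[3]}]_3) :
  common_divisor_free F ->
  (forall i, exists N, koszul F ('X_i ^+ N *: a)) -> koszul F a.
Proof.
move=> cdf /choice [N HN]; pose M := \max_i N i.
have HM i : koszul F ('X_i ^+ M *: a).
  have leN : (N i <= M)%N by apply: leq_bigmax.
  by rewrite -(subnK leN) exprD -scalerA; apply: koszulZ.
apply: (koszul_depth cdf _ _ _ (HM 0) (HM 1) (HM 2%:R)).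
- by rewrite expf_neq0 // -msize_poly_eq0 msizeX.
- by move=> t; apply: dvdr_Xn_mul.
- by move=> tx ty tz; apply: Xn_regular.
Qed.

(** * Affine charts *)

Lemma dhomog_Xn (k : comNzRingType) n (j : 'I_n) N :
  'X_j ^+ N \is [in k[n], N.-homog].
Proof. by rewrite mpolyXn dhomogX /= mdegMn mdeg1 mul1n. Qed.

Section Chart.
Variables (k : fieldType) (i : 'I_3).
Local Notation R := {mpoly k[3]}.
Local Notation S := {poly {poly k}}.
Local Notation Q := {fraction R}.
Local Notation "x %:F" := (@FracField.tofrac R x).

Definition polyC2 : {rmorphism k -> S} :=
  GRing.RMorphism.clone _ _
    ((@polyC {poly k} : {rmorphism _ -> _}) \o (@polyC k : {rmorphism _ -> _})) _.

Definition chart_var (j : 'I_3) : S :=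
  if j == i then 1 else if j == i + 1 then 'X%:P else 'X.

(* [chart] sets ['X_i] to 1; [unchart] maps the two remaining variables to    *)
(* their quotients by ['X_i].                                                 *)
Definition chart : {rmorphism R -> S} :=
  GRing.RMorphism.clone _ _ (mmap polyC2 chart_var) _.

Definition fracC : {rmorphism k -> Q} :=
  GRing.RMorphism.clone _ _
    ((@FracField.tofrac R : {rmorphism _ -> _}) \o
     (mpolyC 3 (R := k) : {rmorphism _ -> _})) _.

Definition unchart : {rmorphism S -> Q} :=
  poly_ext (poly_ext fracC (('X_(i + 1))%:F / ('X_i)%:F))
    (('X_(i + 2%:R))%:F / ('X_i)%:F).

Lemma chartC c : chart c%:MP = c%:P%:P.
Proof. by rewrite /chart /= mmapC. Qed.

Lemma chartX j : chart 'X_j = chart_var j.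
Proof. by rewrite /chart /= mmapX mmap1U. Qed.

Lemma chartXi : chart 'X_i = 1.
Proof. by rewrite chartX /chart_var eqxx. Qed.

Lemma Xi_frac_neq0 : ('X_i)%:F != 0.
Proof. by rewrite tofrac_eq0 -msize_poly_eq0 msizeX. Qed.

Lemma unchart_chartX j : unchart (chart 'X_j) = ('X_j)%:F / ('X_i)%:F.
Proof.
rewrite chartX /chart_var; case: eqP => [->|/eqP ji].
  by rewrite rmorph1 divff // Xi_frac_neq0.
case: eqP => [->|/eqP ji1]; first by rewrite /unchart poly_extC poly_extX.
rewrite /unchart poly_extX; congr (('X_(_))%:F / _).
apply/val_inj; move: ji ji1; case: i => [[|[|[|//]]] ?];
  by case: j => [[|[|[|//]]] ?].
Qed.

Lemma unchart_chartE d F : F \is d.-homog ->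
  unchart (chart F) = F%:F / ('X_i)%:F ^+ d.
Proof.
move=> /dhomogP hF; rewrite [in RHS](mpolyE F) [in RHS]rmorph_sum mulr_suml.
rewrite {1}(mpolyE F) (rmorph_sum chart) (rmorph_sum unchart).
rewrite [LHS]big_seq [RHS]big_seq; apply: eq_bigr => m mF.
rewrite -mul_mpolyC !rmorphM -mulrA; congr (_ * _).
  by rewrite chartC /unchart !poly_extC.
have <- : mdeg m = d by apply: hF.
rewrite mdegE mpolyXE_id !rmorph_prod -prodrXr -prodf_div.
by apply: eq_bigr => j _; rewrite !rmorphXn unchart_chartX expr_div_n.
Qed.

Lemma chart_inj d F G : F \is d.-homog -> G \is d.-homog ->
  chart F = chart G -> F = G.
Proof.
move=> hF hG /(congr1 unchart); rewrite (unchart_chartE hF) (unchart_chartE hG) => /mulIf E.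
apply/eqP; rewrite -tofrac_eq; apply/eqP/E.
by rewrite invr_eq0 expf_neq0 // Xi_frac_neq0.
Qed.

(** Multiplication by ['X_i] raises the degree without changing the image, so lifts exist in every
    large degree; this freedom serves to match degrees in equations. *)
Lemma chart_lift s : exists D, forall d, (D <= d)%N ->
  exists2 F, F \is d.-homog & chart F = s.
Proof.
suff [D [F [hF EF]]] : exists D F, F \is D.-homog /\ chart F = s.
  exists D => d leDd; exists ('X_i ^+ (d - D) * F).
    rewrite -{2}(subnK leDd); apply: dhomogM => //.
    exact: dhomog_Xn.
  by rewrite rmorphM rmorphXn chartXi expr1n mul1r.
have add s1 s2 : (exists D F, F \is D.-homog /\ chart F = s1) ->
    (exists D F, F \is D.-homog /\ chart F = s2) ->
    exists D F, F \is D.-homog /\ chart F = s1 + s2.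
  move=> [D [F [hF <-]]] [E [G [hG <-]]].
  exists (D + E)%N, ('X_i ^+ E * F + 'X_i ^+ D * G); split.
    by apply: rpredD; [rewrite addnC|]; apply: dhomogM => //; apply: dhomog_Xn.
  by rewrite rmorphD !rmorphM !rmorphXn chartXi !expr1n !mul1r.
have mul s1 s2 : (exists D F, F \is D.-homog /\ chart F = s1) ->
    (exists D F, F \is D.-homog /\ chart F = s2) ->
    exists D F, F \is D.-homog /\ chart F = s1 * s2.
  move=> [D [F [hF <-]]] [E [G [hG <-]]].
  by exists (D + E)%N, (F * G); rewrite rmorphM; split=> //; apply: dhomogM.
have var j : exists D F, F \is D.-homog /\ chart F = chart_var j.
  by exists 1%N, 'X_j; rewrite -chartX; split=> //; rewrite dhomogX /= mdeg1.
have vX : chart_var (i + 2%:R) = 'X.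
  by rewrite /chart_var; case: i => [[|[|[|//]]] ?].
have vY : chart_var (i + 1) = 'X%:P.
  by rewrite /chart_var; case: i => [[|[|[|//]]] ?].
elim/poly_ind: s => [|p c IHp]; first by exists 0%N, 0; rewrite rmorph0 rpred0.
apply: (add); first by apply: (mul) => //; rewrite -vX.
elim/poly_ind: c => [|q c IHq]; first by exists 0%N, 0; rewrite polyC0 rmorph0 rpred0.
rewrite polyCD polyCM; apply: (add); first by apply: (mul) => //; rewrite -vY.
exists 0%N, c%:MP; rewrite chartC; split=> //.
by rewrite -[c%:MP]mulr1 mul_mpolyC; apply: rpredZ; apply: dhomog1.
Qed.

Lemma unchart_inj : injective unchart.
Proof.
move=> s t E; have [D HD] := chart_lift s; have [D' HD'] := chart_lift t.
have [F hF EF] := HD _ (leq_addr D' D); have [G hG EG] := HD' _ (leq_addl D D').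
move: E; rewrite -EF -EG (unchart_chartE hF) (unchart_chartE hG) => /mulIf E; congr (chart _).
apply/eqP; rewrite -tofrac_eq; apply/eqP/E.
by rewrite invr_eq0 expf_neq0 // Xi_frac_neq0.
Qed.

End Chart.

Lemma chart_lift_fam (k : fieldType) i (T : finType) (s : T -> {poly {poly k}}) :
  exists D, forall e : T -> nat, (forall t, (D <= e t)%N) ->
  exists U : T -> {mpoly k[3]}, forall t,
    U t \is (e t).-homog /\ @chart k i (U t) = s t.
Proof.
have /choice [D HD] t := @chart_lift k i (s t).
exists (\max_t D t)%N => e le_e.
suff H t : exists U, U \is (e t).-homog /\ @chart k i U = s t.
  by have [U HU] := choice H; exists U.
have [|U hU EU] := HD t (e t); last by exists U.
by apply: leq_trans (le_e t); apply: leq_bigmax.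
Qed.

(** * Comparison of homogeneous vectors with their charts *)

Section HomogVector.
Variables (k : fieldType) (F : 'rV[{mpoly k[3]}]_3) (d : 'I_3 -> nat).
Variable i : 'I_3.
Hypothesis hF : forall j, F 0 j \is (d j).-homog.
Local Notation ch := (@chart k i).
Local Notation f := (map_mx ch F).
Local Notation sumd := (\sum_j d j)%N.

Lemma leq_sumd j : (d j <= sumd)%N.
Proof. by rewrite (bigD1 j) //= leq_addr. Qed.

Lemma dhomog_dot (a : 'rV[{mpoly k[3]}]_3) E : (forall j, a 0 j \is (E - d j).-homog) ->
  (forall j, (d j <= E)%N) -> dot a F \is E.-homog.
Proof.
move=> ha leE; apply: rpred_sum => j _.
by rewrite -(subnK (leE j)); apply: dhomogM.
Qed.

(** The divisibilities lift to homogeneous equations after multiplication by a power of ['X_i],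
    which dehomogenizes to 1. *)
Lemma chart_cdf : common_divisor_free F -> common_divisor_free f.
Proof.
move=> cdf t s /choice [w Hw].
have [D1 H1] := @chart_lift k i t; have [T hT ET] := H1 _ (leqnn _).
have [D2 H2] := @chart_lift k i s; have [U hU EU] := H2 _ (leqnn _).
have [D3 H3] := @chart_lift_fam k i _ w.
have [|W HW] := H3 (fun j => (D3 + D1 + D2 + d j) - D1)%N.
  by move=> j; lia.
have [W' EW] : dvdr T ('X_i ^+ (D3 + D1) * U).
  apply: cdf => j; exists (W j); have [hW EWj] := HW j.
  apply: (@chart_inj k i (D3 + D1 + D2 + d j)).
  - by apply: dhomogM => //; apply: dhomogM => //; apply: dhomog_Xn.
  - have -> : (D3 + D1 + D2 + d j = D1 + ((D3 + D1 + D2 + d j) - D1))%N by lia.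
    exact: dhomogM.
  - rewrite !rmorphM rmorphXn chartXi expr1n mul1r EU ET EWj -Hw.
    by rewrite mxE.
exists (ch W'); rewrite -ET -rmorphM -EW rmorphM rmorphXn chartXi expr1n.
by rewrite mul1r EU.
Qed.

(** Lifting the coefficients [u] rather than [a] itself keeps the entries of the lift in the
    ideal. *)
Lemma chart_koszul :
  (forall a, dot a F = 0 -> (forall j, inideal F (a 0 j)) -> koszul F a) ->
  forall a, dot a f = 0 -> (forall j, inideal f (a 0 j)) -> koszul f a.
Proof.
move=> KV a af /choice [u Hu].
have [D HD] := @chart_lift_fam k i ('I_3 * 'I_3)%type (fun p => u p.1 0 p.2).
pose E := (D + sumd + sumd)%N.
have [|U HU] := HD (fun p => E - d p.1 - d p.2)%N.
  by move=> [j l] /=; have := leq_sumd j; have := leq_sumd l; rewrite /E; lia.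
pose A : 'rV[{mpoly k[3]}]_3 := \row_j dot (\row_l U (j, l)) F.
have leE j : (d j <= E)%N by have := leq_sumd j; rewrite /E; lia.
have EA : map_mx ch A = a.
  apply/rowP => j; rewrite !mxE map_dot Hu; congr dot.
  by apply/rowP => l; rewrite !mxE; have [_ ->] := HU (j, l).
have hA j : A 0 j \is (E - d j).-homog.
  rewrite mxE; apply: dhomog_dot => l; first by rewrite mxE; have [] := HU (j, l).
  by have := leq_sumd j; have := leq_sumd l; rewrite /E; lia.
have [|j|e Ee] := KV A.
- apply: (@chart_inj k i E); [exact: dhomog_dot|exact: rpred0|].
  by rewrite map_dot EA af rmorph0.
- by rewrite mxE; exists (\row_l U (j, l)).
by exists (map_mx ch e); rewrite -map_cross -Ee.
Qed.

(** The condition says that [a] has degree [E] in the module with shifts [d]; since subtraction is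
    truncated, entries with [d j] above [E] are set to 0 separately. *)
Lemma koszul_of_chart (a : 'rV[{mpoly k[3]}]_3) E :
  (forall j, if (d j <= E)%N then a 0 j \is (E - d j).-homog else a 0 j == 0) ->
  koszul f (map_mx ch a) -> exists N, koszul F ('X_i ^+ N *: a).
Proof.
move=> ha [e Ee].
have [D HD] := @chart_lift_fam k i _ (fun j => e 0 j).
have [|U HU] := HD (fun j => D + E + d j)%N; first by move=> j; lia.
exists (D + sumd)%N, (\row_j U j); apply/rowP => j.
apply: (@chart_inj k i (D + E + sumd - d j)).
- rewrite mxE; have := ha j; case: ifP => [lej haj|_ /eqP ->]; last first.
    by rewrite mulr0 rpred0.
  have -> : (D + E + sumd - d j = (D + sumd) + (E - d j))%N by lia.
  by apply: dhomogM => //; apply: dhomog_Xn.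
- have Ed : (sumd = d j + (d (j + 1)%R + d (j + 2%:R)%R))%N by apply: (big_ord3 _ j).
  rewrite !mxE; apply: rpredB.
    have -> : (D + E + sumd - d j = (D + E + d (j + 1)%R) + d (j + 2%:R)%R)%N by lia.
    by apply: dhomogM => //; have [] := HU (j + 1).
  have -> : (D + E + sumd - d j = (D + E + d (j + 2%:R)%R) + d (j + 1)%R)%N by lia.
  by apply: dhomogM => //; have [] := HU (j + 2%:R).
- rewrite mxE rmorphM rmorphXn chartXi expr1n mul1r.
  have /rowP /(_ j) := Ee; rewrite mxE => ->.
  have /rowP /(_ j) := map_cross ch (\row_j U j) F; rewrite mxE => ->.
  congr (cross _ _ 0 j); apply/rowP => l; rewrite !mxE.
  by have [_ ->] := HU l.
Qed.

End HomogVector.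

(** * Ideals generated by regular sequences *)

Section IdealGen.
Variable A : comNzRingType.

Lemma ideal_gen_ideal (X : set A) : ideal_pred (ideal_gen X).
Proof.
split.
- exists 0%N, (fun _ => 0), (fun _ => 0); split; first by case.
  by rewrite big_ord0.
- move=> _ _ [n [c [g [Xg ->]]]] [m [c' [g' [Xg' ->]]]].
  exists (n + m)%N.
  exists (fun i => match split i with inl j => c j | inr j => c' j end).
  exists (fun i => match split i with inl j => g j | inr j => g' j end).
  split; first by move=> i; case: (split i).
  rewrite big_split_ord /=; congr (_ + _); apply: eq_bigr => i _.
    by rewrite (unsplitK (inl i)).
  by rewrite (unsplitK (inr i)).
- move=> a _ [n [c [g [Xg ->]]]]; exists n, (fun i => a * c i), g; split=> //.
  by rewrite mulr_sumr; apply: eq_bigr => i _; apply: mulrA.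
Qed.

Lemma ideal_gen_mem (X : set A) x : X x -> ideal_gen X x.
Proof.
move=> Xx; exists 1%N, (fun=> 1), (fun=> x); split=> //.
by rewrite big_ord1 scale1r.
Qed.

Lemma ideal_gen_min (X : set A) (J : A -> Prop) : ideal_pred J ->
  (forall x, X x -> J x) -> forall x, ideal_gen X x -> J x.
Proof.
move=> iJ XJ _ [n [c [g [Xg ->]]]]; apply: (big_ind J).
- exact: ideal_pred0 iJ.
- exact: ideal_predD iJ.
- by move=> i _; apply: (ideal_predM iJ _ (XJ _ (Xg i))).
Qed.

Lemma ideal_gen_seqP (s : seq A) x : ideal_gen [set` s] x <->
  exists c : nat -> A, x = \sum_(i < size s) c i * s`_i.
Proof.
split=> [|[c ->]]; last first.
  apply: ideal_pred_sum => [|i _]; first exact: ideal_gen_ideal.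
  by apply: ideal_predM; [exact: ideal_gen_ideal|apply: ideal_gen_mem; apply: mem_nth].
pose J x := exists c : nat -> A, x = \sum_(i < size s) c i * s`_i.
apply: (@ideal_gen_min _ J) => [|y /= ys].
  split.
  - by exists (fun=> 0); rewrite big1 // => i _; rewrite mul0r.
  - move=> _ _ [c ->] [c' ->]; exists (fun i => c i + c' i).
    by rewrite -big_split; apply: eq_bigr => i _; rewrite mulrDl.
  - move=> a _ [c ->]; exists (fun i => a * c i).
    by rewrite mulr_sumr; apply: eq_bigr => i _; rewrite mulrA.
have lts : (index y s < size s)%N by rewrite index_mem.
exists (fun i => (i == index y s)%:R); rewrite (bigD1 (Ordinal lts)) //=.
rewrite eqxx mul1r nth_index // big1 ?addr0 // => i ni.
have /negbTE -> : (i != index y s :> nat) by [].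
by rewrite mul0r.
Qed.

Lemma inideal_genE (f1 f2 f3 : A) x :
  ideal_gen [set f1; f2; f3] x <-> inideal (\row_j [tuple f1; f2; f3]`_j) x.
Proof.
split.
  apply: ideal_gen_min; first exact: inideal_ideal.
  move=> y [[->|->]|->].
  - by have := inideal_gen (\row_j [tuple f1; f2; f3]`_j) (0 : 'I_3); rewrite mxE.
  - by have := inideal_gen (\row_j [tuple f1; f2; f3]`_j) (1 : 'I_3); rewrite mxE.
  - by have := inideal_gen (\row_j [tuple f1; f2; f3]`_j) (2%:R : 'I_3); rewrite mxE.
move=> [w ->]; apply: ideal_pred_sum => [|j _]; first exact: ideal_gen_ideal.
apply: ideal_predM; first exact: ideal_gen_ideal.
apply: ideal_gen_mem; rewrite mxE.
by case: j => [[|[|[|//]]] ?]; [left; left|left; right|right].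
Qed.

(** The [W i] carry syzygies of [s] to syzygies of [G]. By regularity the last coefficient lies in
    the ideal of the preceding elements, so Koszul syzygies remove it and induction applies. *)
Lemma regular_seq_syz (G : 'rV[A]_3) (s : seq A) (W : nat -> 'rV[A]_3) n
    (c : nat -> A) :
  regular_seq s -> (forall i, (i < size s)%N -> dot (W i) G = s`_i) ->
  (n <= size s)%N -> \sum_(i < n) c i * s`_i = 0 ->
  koszul G (\sum_(i < n) c i *: W i).
Proof.
move=> [reg _] HW; elim: n c => [|n IHn] c len.
  by rewrite !big_ord0 => _; exists 0; rewrite cross0l.
rewrite !big_ord_recr /= => E.
have : ideal_gen [set` take n s] (s`_n * c n).
  have -> : s`_n * c n = - \sum_(i < n) c i * s`_i.
    by apply/eqP; rewrite -addr_eq0 addrC mulrC; apply/eqP.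
  apply: ideal_predN; first exact: ideal_gen_ideal.
  apply/ideal_gen_seqP; exists c; rewrite size_takel ?(ltnW len) //.
  by apply: eq_bigr => i _; rewrite nth_take.
move=> /(reg n len) /ideal_gen_seqP [e]; rewrite size_takel ?(ltnW len) // => Ee.
have {}Ee : c n = \sum_(i < n) e i * s`_i.
  by rewrite Ee; apply: eq_bigr => i _; rewrite nth_take.
have -> : \sum_(i < n) c i *: W i + c n *: W n =
    \sum_(i < n) (c i + e i * s`_n) *: W i
    + \sum_(i < n) e i *: cross (cross (W i) (W n)) G.
  rewrite Ee scaler_suml -!big_split; apply: eq_bigr => i _ /=.
  rewrite cross_cross !HW //; last exact: leq_trans (ltn_ord i) (ltnW len).
  by apply/rowP => l; rewrite !mxE; ring.
apply: koszulD.
  apply: (IHn (fun i => c i + e i * s`_n)); first exact: ltnW.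
  rewrite -[RHS]E Ee mulr_suml -big_split; apply: eq_bigr => i _ /=; ring.
exists (\sum_(i < n) e i *: cross (W i) (W n)).
by rewrite cross_suml; apply: eq_bigr => i _; rewrite crossZl.
Qed.

(* Rewrite the generators [G] in terms of the regular sequence and back: the  *)
(* two-fold substitution differs from the identity by syzygies of [G], which  *)
(* become Koszul ones after multiplication by elements of the ideal.          *)
Lemma regular_seq_koszul (G b : 'rV[A]_3) (s : seq A) : regular_seq s ->
  (forall x, ideal_gen [set` s] x <-> inideal G x) ->
  dot b G = 0 -> (forall j, inideal G (b 0 j)) -> koszul G b.
Proof.
move=> regs sG bG /choice [U HU].
have /choice [W HW] i : exists w, dot w G = s`_i.
  have [lt|ge] := ltnP i (size s); last by exists 0; rewrite dot0l nth_default.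
  have /sG [w Ew] : ideal_gen [set` s] s`_i by apply: ideal_gen_mem; apply: mem_nth.
  by exists w.
have /choice [T HT] j : exists c : nat -> A, G 0 j = \sum_(i < size s) c i * s`_i.
  by apply/ideal_gen_seqP/sG; apply: inideal_gen.
pose c i := \sum_j b 0 j * T j i.
have -> : b = \sum_(i < size s) c i *: W i
    + \sum_j b 0 j *: (delta_mx 0 j - \sum_(i < size s) T j i *: W i).
  have -> : \sum_(i < size s) c i *: W i =
      \sum_j b 0 j *: \sum_(i < size s) T j i *: W i.
    under [RHS]eq_bigr do rewrite scaler_sumr.
    rewrite [RHS]exchange_big; apply: eq_bigr => i _.
    by rewrite scaler_suml; apply: eq_bigr => j _; rewrite scalerA.
  rewrite -big_split /= {1}(row_sum_delta b); apply: eq_bigr => j _.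
  by rewrite -scalerDr addrC subrK.
apply: koszulD.
  apply: (@regular_seq_syz _ s) => //; rewrite -[RHS]bG /dot.
  under [RHS]eq_bigr do rewrite HT mulr_sumr.
  rewrite [RHS]exchange_big; apply: eq_bigr => i _.
  by rewrite mulr_suml; apply: eq_bigr => j _; rewrite mulrA.
have syz j : dot (delta_mx 0 j - \sum_(i < size s) T j i *: W i) G = 0.
  rewrite dotDl dotNl dot_deltal HT; apply/eqP; rewrite subr_eq0; apply/eqP.
  rewrite /dot; under [RHS]eq_bigr do rewrite summxE mulr_suml.
  rewrite [RHS]exchange_big; apply: eq_bigr => i _; rewrite -HW mulr_sumr.
  by apply: eq_bigr => l _; rewrite mxE mulrA.
exists (\sum_j cross (U j) (delta_mx 0 j - \sum_(i < size s) T j i *: W i)).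
by rewrite cross_suml; apply: eq_bigr => j _; rewrite -koszul_mul // HU.
Qed.

End IdealGen.

(** * Local rings of the projective plane *)

Lemma frac_shift (K : fieldType) (a b x : K) d e : x != 0 -> b != 0 ->
  a / x ^+ d = x ^+ e * a / (x ^+ d * b) * (b / x ^+ e).
Proof. by move=> x0 b0; field; rewrite b0 !expf_neq0. Qed.

Section LocalChart.
Variables (k : fieldType) (p : proj_point k) (i : 'I_3).
Hypothesis Xip : 'X_i \notin p.
Local Notation R := {mpoly k[3]}.
Local Notation S := {poly {poly k}}.
Local Notation A := (local_ring p).
Local Notation ch := (@chart k i).
Local Notation u := (@unchart k i).
Local Notation "x %:F" := (@FracField.tofrac R x).

Definition chart_point (s : S) : Prop :=
  exists d H, [/\ H \is d.-homog, H \in p & ch H = s].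
Local Notation M := chart_point.

Lemma Xin_notin n : 'X_i ^+ n \notin p.
Proof.
elim: n => [|n IHn]; first by rewrite expr0 idealr1.
by rewrite exprS prime_idealrM negb_or Xip.
Qed.

(** Homogeneous elements with the same image agree up to powers of ['X_i], which lie outside of
    [p]. *)
Lemma chart_pointE d H : H \is d.-homog -> M (ch H) <-> H \in p.
Proof.
move=> hH; split=> [[e [G [hG Gp E]]]|Hp]; last by exists d, H.
have : 'X_i ^+ e * H \in p.
  have -> : 'X_i ^+ e * H = 'X_i ^+ d * G.
    apply: (@chart_inj k i (e + d)).
    - by apply: dhomogM => //; apply: dhomog_Xn.
    - by rewrite addnC; apply: dhomogM => //; apply: dhomog_Xn.
    - by rewrite !rmorphM !rmorphXn chartXi !expr1n !mul1r.
  exact: idealMr.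
by rewrite prime_idealrM (negbTE (Xin_notin e)).
Qed.

Lemma chart_point_prime : prime_pred M.
Proof.
split; first split.
- by exists 0%N, 0; rewrite rpred0 rmorph0; split=> //; apply: rpred0.
- move=> _ _ [d [G [hG Gp <-]]] [e [H [hH Hp <-]]].
  exists (d + e)%N, ('X_i ^+ e * G + 'X_i ^+ d * H); split.
  + by apply: rpredD; [rewrite addnC|]; apply: dhomogM => //; apply: dhomog_Xn.
  + by apply: rpredD; apply: idealMr.
  + by rewrite rmorphD !rmorphM !rmorphXn chartXi !expr1n !mul1r.
- move=> s _ [e [H [hH Hp <-]]].
  have [D HD] := @chart_lift k i s; have [G hG <-] := HD _ (leqnn _).
  exists (D + e)%N, (G * H); rewrite rmorphM; split=> //; first exact: dhomogM.
  exact: idealMr.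
- have E1 : ch 1 = 1 by rewrite rmorph1.
  have h1 : (1 : R) \is 0.-homog by apply: dhomog1.
  by rewrite -E1 => /(chart_pointE h1); rewrite idealr1.
- move=> s t; have [D HD] := @chart_lift k i s; have [G hG <-] := HD _ (leqnn _).
  have [D' HD'] := @chart_lift k i t; have [H hH <-] := HD' _ (leqnn _).
  rewrite -rmorphM => /(chart_pointE (dhomogM hG hH)).
  rewrite prime_idealrM => /orP [Gp|Hp].
    by left; apply/(chart_pointE hG).
  by right; apply/(chart_pointE hH).
Qed.

Lemma unchart_neq0 t : ~ M t -> u t != 0.
Proof.
move=> nMt; apply/eqP => ut; apply: nMt.
have -> : t = 0 by apply: (@unchart_inj k i); rewrite ut rmorph0.
exact: ideal_pred0 chart_point_prime.
Qed.

Lemma hfrac_unchart (I : set R) x : hfrac p I x -> exists s t,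
  [/\ exists2 a, I a & s = ch a, ~ M t & x * u t = u s].
Proof.
move=> [d [a [s [ha hs Ia sp ->]]]]; exists (ch a), (ch s).
have nMs : ~ M (ch s) by move/(chart_pointE hs); apply/negP.
split=> //; first by exists a.
rewrite (unchart_chartE i ha) (unchart_chartE i hs).
have s0 : s%:F != 0.
  by rewrite tofrac_eq0; apply: contraNneq sp => ->; apply: rpred0.
by rewrite mulrA divfK.
Qed.

Lemma unchart_hfrac (I : set R) x d e a b : a \is d.-homog -> b \is e.-homog ->
  (forall c, I (c * a)) -> b \notin p -> x * u (ch b) = u (ch a) -> hfrac p I x.
Proof.
move=> ha hb Ia bp E; exists (d + e)%N, ('X_i ^+ e * a), ('X_i ^+ d * b); split.
- by rewrite addnC; apply: dhomogM => //; apply: dhomog_Xn.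
- by apply: dhomogM => //; apply: dhomog_Xn.
- exact: Ia.
- by rewrite prime_idealrM negb_or Xin_notin.
- have nMb : ~ M (ch b) by move/(chart_pointE hb); apply/negP.
  apply: (mulIf (unchart_neq0 nMb)); rewrite E.
  rewrite (unchart_chartE i ha) (unchart_chartE i hb) !tofracM !tofracXn.
  have b0 : b%:F != 0.
    by rewrite tofrac_eq0; apply: contraNneq bp => ->; apply: rpred0.
  have x0 := Xi_frac_neq0 k i.

  exact (frac_shift _ d e x0 b0).
Qed.

Lemma local_fracP (x : A) : exists s t, ~ M t /\ val x * u t = u s.
Proof.
have /asboolP /hfrac_unchart [s [t [_ nMt E]]] := local_valP x.
by exists s, t.
Qed.

Lemma local_frac s t : ~ M t -> exists x : A, val x * u t = u s.
Proof.
move=> nMt; pose y := u s / u t.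
have Ey : y * u t = u s by rewrite divfK ?unchart_neq0.
suff ly : y \in local_pred p by exists (LocalRing ly).
apply/asboolP.
have [D HD] := @chart_lift k i s; have [G hG EG] := HD _ (leqnn _).
have [D' HD'] := @chart_lift k i t; have [H hH EH] := HD' _ (leqnn _).
apply: (@unchart_hfrac setT y D D' G H) => //; last by rewrite EG EH.
by apply/negP => /(chart_pointE hH); rewrite EH; apply: nMt.
Qed.

Lemma unchart_local s : u s \in local_pred p.
Proof.
have [|x] := @local_frac s 1; first exact: prime_pred1 chart_point_prime.
by rewrite rmorph1 mulr1 => <-; apply: local_valP.
Qed.

(** The local ring is the localization of the chart at [M]; this is the canonical map. *)
Definition loc_fun s : A := LocalRing (unchart_local s).

Lemma loc_zmod : zmod_morphism loc_fun.
Proof.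
by move=> s t; apply/val_inj; rewrite -[LHS]/(u (s - t)) GRing.valB rmorphB.
Qed.

Lemma loc_monoid : monoid_morphism loc_fun.
Proof.
split=> [|s t]; apply/val_inj; first by rewrite -[LHS]/(u 1) GRing.val1 rmorph1.
by rewrite -[LHS]/(u (s * t)) GRing.valM rmorphM.
Qed.

HB.instance Definition _ := GRing.isZmodMorphism.Build S A loc_fun loc_zmod.
HB.instance Definition _ := GRing.isMonoidMorphism.Build S A loc_fun loc_monoid.

Definition loc : {rmorphism S -> A} := GRing.RMorphism.clone _ _ loc_fun _.

End LocalChart.

(** * Stalks of the ideal sheaf *)

Section Stalk.
Variables (k : fieldType) (F : 'rV[{mpoly k[3]}]_3) (d : 'I_3 -> nat).
Hypothesis hF : forall j, F 0 j \is (d j).-homog.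
Variables (p : proj_point k) (i : 'I_3).
Hypothesis Xip : 'X_i \notin p.
Variable I : set {mpoly k[3]}.
Hypothesis IE : forall x, I x <-> inideal F x.
Local Notation S := {poly {poly k}}.
Local Notation A := (local_ring p).
Local Notation ch := (@chart k i).
Local Notation u := (@unchart k i).
Local Notation M := (chart_point p i).
Local Notation f := (map_mx ch F).
Local Notation L := (loc Xip).
Local Notation g := (map_mx L f).

Lemma val_loc s : val (L s) = u s. Proof. by []. Qed.

Lemma loc_inj : injective L.
Proof. by move=> s t /(congr1 val); rewrite !val_loc => /unchart_inj. Qed.

Lemma local_fracL (x : A) : exists s t, ~ M t /\ x * L t = L s.
Proof.
have [s [t [nMt E]]] := local_fracP Xip x; exists s, t; split=> //.
by apply/val_inj; rewrite GRing.valM !val_loc.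
Qed.

Lemma local_divL s t : ~ M t -> exists x : A, x * L t = L s.
Proof.
move=> nMt; have [x E] := local_frac Xip s nMt; exists x.
by apply/val_inj; rewrite GRing.valM !val_loc.
Qed.

Lemma local_mulIL t : ~ M t -> injective ( *%R^~ (L t)).
Proof.
move=> nMt x y /(congr1 val); rewrite !GRing.valM => E.
by apply/val_inj/(mulIf (unchart_neq0 Xip nMt)).
Qed.

Lemma common_denominator (e : 'rV[A]_3) : exists (v : 'rV[S]_3) t,
  ~ M t /\ L t *: e = map_mx L v.
Proof.
have /choice [s /choice [t H]] j := local_fracL (e 0 j).
exists (\row_j (s j * \prod_(l | l != j) t l)), (\prod_l t l); split.
  have pM := chart_point_prime Xip.
  by elim/big_ind: _ => [|x y nMx nMy /(prime_predP pM) []//|l _];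
     [exact: prime_pred1 pM|have [] := H l].
apply/rowP => j; rewrite !mxE (bigD1 j) //= !rmorphM mulrAC; congr (_ * _).
by rewrite mulrC; have [] := H j.
Qed.

(** One direction dehomogenizes a combination of the generators; the other clears denominators and
    lifts the coefficients to degrees that make the combination homogeneous. *)
Lemma stalkP x : ideal_stalk p I x <-> inideal g x.
Proof.
split=> [/(hfrac_unchart Xip) [s [t [[a /IE [w ->] ->] nMt E]]]|[y ->]].
  have /choice [c Hc] j := local_divL (ch (w 0 j)) nMt.
  exists (\row_j c j); apply: (local_mulIL nMt).
  have -> : x * L t = L (ch (dot w F)).
    by apply/val_inj; rewrite GRing.valM !val_loc.
  rewrite !map_dot mulrC -dotZl; congr dot; apply/rowP => j.
  by rewrite !mxE mulrC Hc.
have [v [t [nMt E]]] := common_denominator y.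
have [D HD] := @chart_lift_fam k i _ (fun j => v 0 j).
have [|W HW] := HD (fun j => D + \sum_l d l - d j)%N.
  by move=> j; have := leq_sumd d j; lia.
have [e He] := @chart_lift k i t; have [b hb Eb] := He _ (leqnn _).
apply: (@unchart_hfrac _ _ _ Xip _ _ (D + \sum_l d l) e (dot (\row_j W j) F) b) => //.
- apply: (dhomog_dot hF) => j; first by rewrite mxE; have [] := HW j.
  by have := leq_sumd d j; lia.
- by move=> c; apply/IE; apply: ideal_predM; [exact: inideal_ideal|exists (\row_j W j)].
- by apply/negP => /(chart_pointE Xip hb); rewrite Eb.
- rewrite Eb -!val_loc -GRing.valM; congr val.
  rewrite mulrC -dotZl E !map_dot; congr dot; apply/rowP => j.
  by rewrite !mxE; have [_ ->] := HW j.
Qed.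

Lemma chart_point_F : (forall j, F 0 j \in p) -> forall j, M (f 0 j).
Proof. by move=> Fp j; rewrite mxE; apply/(chart_pointE Xip (hF j)). Qed.

(** A syzygy with a unit entry at [j] expresses [f 0 j] locally through [f1] and [f2]; the same unit
    transfers the absence of common divisors from [f] to this pair, which makes it regular. *)
Lemma stalk_regular : common_divisor_free F ->
  (forall a, dot a F = 0 -> (forall j, inideal F (a 0 j)) -> koszul F a) ->
  (forall j, F 0 j \in p) ->
  exists s : seq A, regular_seq s /\ ideal_stalk p I = ideal_gen [set` s].
Proof.
move=> cdfF KV Fp; have pM := chart_point_prime Xip; have Mf := chart_point_F Fp.
have cdf : common_divisor_free f := chart_cdf hF cdfF.
have [c [j [cf nMc]]] := chart_syz_unit cdf pM Mf (chart_koszul hF KV).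
pose f1 := f 0 (j + 1); pose f2 := f 0 (j + 2%:R).
have Ecf : c 0 j * f 0 j = - (c 0 (j + 1) * f1) - c 0 (j + 2%:R) * f2.
  apply/eqP; rewrite -subr_eq0 -[X in _ == X]cf (dotE j); apply/eqP.
  by rewrite /f1 /f2; ring.
have cdf' (t s : S) : dvdr t (s * f1) -> dvdr t (s * f2) -> dvdr t (s * c 0 j).
  move=> d1 d2; apply: cdf => l; have it := dvdr_ideal t.
  case: (ord3P j l) => ->.
  - have -> : s * c 0 j * f 0 j =
        - (c 0 (j + 1) * (s * f1)) - c 0 (j + 2%:R) * (s * f2).
      by rewrite -mulrA Ecf; ring.
    by apply: ideal_predB => //; [apply: ideal_predN => //|]; apply: ideal_predM.
  - by rewrite mulrAC mulrC; apply: ideal_predM.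
  - by rewrite mulrAC mulrC; apply: ideal_predM.
(* If [f1] were 0, [f2] would divide both and hence [c 0 j], which would then lie in [M]. *)
have f10 : f1 != 0.
  apply/eqP => f10; apply: nMc.
  have [||w Ew] := @cdf' f2 1.
  - by rewrite f10 mulr0; exists 0; rewrite mulr0.
  - by rewrite mul1r; exists 1; rewrite mulr1.
  by rewrite mul1r in Ew; rewrite Ew mulrC; apply: (ideal_predM pM); apply: Mf.
have nMM s t : ~ M s -> ~ M t -> ~ M (s * t).
  by move=> nMs nMt /(prime_predP pM) [].
pose gs := [:: L f1; L f2]; exists gs.
have sub x : ideal_gen [set` gs] x -> inideal g x.
  apply: ideal_gen_min; first exact: inideal_ideal.
  move=> y /=; rewrite !inE => /orP [] /eqP ->.
    by have := inideal_gen g (j + 1); rewrite mxE.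
  by have := inideal_gen g (j + 2%:R); rewrite mxE.
split; last first.
  apply/seteqP; split=> x; last by move/sub => ?; apply/stalkP.
  move/stalkP => [y ->].
  have ig := ideal_gen_ideal [set` gs].
  have g1 : ideal_gen [set` gs] (L f1) by apply: ideal_gen_mem; rewrite /= mem_head.
  have g2 : ideal_gen [set` gs] (L f2).
    by apply: ideal_gen_mem; rewrite /= !inE eqxx orbT.
  apply: ideal_pred_sum => // l _; apply: ideal_predM => //.
  case: (ord3P j l) => ->; rewrite [g _ _]mxE // -/f1 -/f2.
  have [z Ez] := local_divL 1 nMc.
  have -> : L (f 0 j) = z * (- (L (c 0 (j + 1)) * L f1) - L (c 0 (j + 2%:R)) * L f2).
    rewrite -!rmorphM -rmorphN -rmorphB -Ecf rmorphM mulrA Ez rmorph1.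
    by rewrite mul1r.
  apply: ideal_predM => //; apply: ideal_predB => //; last exact: ideal_predM.
  by apply: ideal_predN => //; apply: ideal_predM.
split; last first.
  move/sub => [y E1]; have [v [t [nMt E]]] := common_denominator y.
  apply: nMt; have -> : t = dot v f.
    by apply: loc_inj; rewrite map_dot -E dotZl -E1 mulr1.
  apply: ideal_pred_sum => [|l _]; first exact: pM.
  by apply: (ideal_predM pM); apply: Mf.
move=> [|[|//]] _ x /= /ideal_gen_seqP [z]; rewrite ?big_ord0 ?big_ord1 /= => E;
  have [s [t [nMt Ex]]] := local_fracL x.
  apply: (_ : x = 0 -> _); first by move=> ->; apply: ideal_pred0 (ideal_gen_ideal _).
  apply: (local_mulIL nMt); rewrite Ex mul0r.
  suff -> : s = 0 by rewrite rmorph0.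
  apply: (mulfI f10); apply: loc_inj; rewrite rmorphM -Ex mulrA E.
  by rewrite mul0r mulr0 rmorph0.
(* With denominators cleared, [f1] divides [s * t' * f2], hence [s * t' * c 0 j], where [t'] and
   [c 0 j] are locally units. *)
have [s' [t' [nMt' Ez]]] := local_fracL (z 0%N).
have Es : f2 * s * t' = s' * f1 * t.
  apply: loc_inj; rewrite !rmorphM -Ex -Ez.
  rewrite mulrA E -!mulrA; congr (_ * _).
  by rewrite [LHS]mulrA mulrC.
have [||w Ew] := @cdf' f1 (s * t').
- by exists (s * t'); rewrite mulrC.
- exists (s' * t); transitivity (f2 * s * t'); first by ring.
  by rewrite Es; ring.
have nMd := nMM _ _ (nMM _ _ nMt nMt') nMc.
have [y Ey] := local_divL w nMd.
have -> : x = y * L f1.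
  apply: (local_mulIL nMd); rewrite [RHS]mulrAC Ey -rmorphM.
  by rewrite [w * _]mulrC -Ew !rmorphM -Ex !mulrA.
by apply/ideal_gen_seqP; exists (fun=> y); rewrite big_ord1.
Qed.

Lemma lci_koszul (a : 'rV[S]_3) :
  (exists s : seq A, regular_seq s /\ ideal_stalk p I = ideal_gen [set` s]) ->
  dot a f = 0 -> (forall j, inideal f (a 0 j)) ->
  exists t, ~ M t /\ koszul f (t *: a).
Proof.
move=> [s [regs Es]] af Ia.
have [||j|e Ee] := @regular_seq_koszul _ g (map_mx L a) s regs.
- by move=> x; rewrite -Es; apply: stalkP.
- by rewrite -map_dot af rmorph0.
- by have [w Ew] := Ia j; exists (map_mx L w); rewrite mxE Ew map_dot.
have [v [t [nMt E]]] := common_denominator e.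
exists t; split=> //; exists v; apply/rowP => j; apply: loc_inj.
have /rowP /(_ j) : map_mx L (t *: a) = map_mx L (cross v f).
  by rewrite map_cross -E crossZl -Ee; apply/rowP => l; rewrite !mxE rmorphM.
by rewrite !mxE.
Qed.

End Stalk.

(** * Points above a prime of a chart *)

(** Zorn's lemma for proper ideals above [J]. Chains may be empty, so the property is imposed on the
    union with [J]. *)
Lemma exists_prime_above (A : comNzRingType) (J : A -> Prop) :
  ideal_pred J -> ~ J 1 -> exists2 M, prime_pred M & forall x, J x -> M x.
Proof.
move=> iJ J1.
pose P (X : set A) := ideal_pred (X `|` J) /\ ~ (X `|` J) 1.
have [F FP totF|Q [[iQ Q1] maxQ]] := @Zorn_bigcup A P.
  split; last by case=> // -[X FX X1]; have [_ []] := FP X FX; left.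
  split.
  - by right; apply: ideal_pred0 iJ.
  - move=> a b Ha Hb.
    have [[X [FX HX]]|[Ja Jb]] :
        (exists X, F X /\ (X `|` J) a /\ (X `|` J) b) \/ (J a /\ J b).
      case: Ha => [[X FX Xa]|Ja]; case: Hb => [[Y FY Yb]|Jb].
      + have [XY|YX] := totF _ _ FX FY; left.
          by exists Y; split=> //; split; left=> //; apply: XY.
        by exists X; split=> //; split; left=> //; apply: YX.
      + by left; exists X; split=> //; split; [left|right].
      + by left; exists Y; split=> //; split; [right|left].
      + by right.
    + have [iX _] := FP X FX.
      by case: (ideal_predD iX HX.1 HX.2) => H; [left; exists X|right].
    + by right; apply: ideal_predD.
  - move=> a b [[X FX Xb]|Jb]; last by right; apply: ideal_predM.
    have [iX _] := FP X FX.
    by case: (ideal_predM iX a (or_introl Xb)) => H; [left; exists X|right].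
exists (Q `|` J); last by right.
split=> // a b Qab; apply: contrapT => /not_orP [na nb].
(* By maximality the ideal [N] obtained by adjoining [a] contains 1; multiplying that relation by
   [b] puts [b] in the maximal ideal. *)
pose N x := exists m r, (Q `|` J) m /\ x = m + r * a.
have JN x : J x -> N x.
  by move=> Jx; exists x, 0; rewrite mul0r addr0; split=> //; right.
have NE : [set x | N x] `|` J = [set x | N x].
  by apply/seteqP; split=> x; [case=> // /JN|left].
apply: (maxQ [set x | N x]).
  split; first by move=> x Qx; exists x, 0; rewrite mul0r addr0; split=> //; left.
  move=> /(_ a) NQ; apply: na; left; apply: NQ.
  by exists 0, 1; rewrite add0r mul1r; split=> //; apply: ideal_pred0 iQ.
rewrite /P NE; split.
  split.
  - by exists 0, 0; rewrite mul0r addr0; split=> //; apply: ideal_pred0 iQ.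
  - move=> _ _ [m [r [Qm ->]]] [m' [r' [Qm' ->]]]; exists (m + m'), (r + r').
    by split; [apply: ideal_predD iQ _ _ Qm Qm'|ring].
  - move=> x _ [m [r [Qm ->]]]; exists (x * m), (x * r).
    by split; [apply: ideal_predM iQ _ _ Qm|ring].
move=> [m [r [Qm E1]]]; apply: nb.
have -> : b = b * m + r * (a * b) by rewrite -{1}[b]mulr1 E1; ring.
by apply: (ideal_predD iQ); apply: (ideal_predM iQ).
Qed.

(** * Graded components *)

Section Components.
Variables (k : fieldType) (n : nat).
Local Notation R := {mpoly k[n]}.
Implicit Types (x F : R).
Local Notation pih := (pihomog mdeg).

Lemma pihomogM_homog x F e N : F \is e.-homog ->
  pih N (x * F) = if (e <= N)%N then pih (N - e) x * F else 0.
Proof.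
move=> hF; pose K := (msize x + N).+1.
have leK : (mmeasure mdeg x <= K)%N by rewrite /K -addnS leq_addr.
rewrite {1}(pihomog_partitionE leK) mulr_suml raddf_sum /=.
have pE (l : 'I_K) : pih N (pih l x * F) = if (l + e == N)%N then pih l x * F else 0.
  have hl : pih l x * F \is (l + e).-homog by apply: dhomogM => //; apply: pihomogP.
  by case: eqP => [E|/eqP ne]; [rewrite -E pihomog_dE|rewrite (pihomog_ne0 ne hl)].
under eq_bigr do rewrite pE.
rewrite -big_mkcond /=; case: leqP => [leN|ltN]; last first.
  by rewrite big1 // => l /eqP E; lia.
have ltK : (N - e < K)%N by rewrite /K; lia.
rewrite (big_pred1 (Ordinal ltK)) // => l /=.
by rewrite -val_eqE /=; apply/eqP/eqP; lia.
Qed.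

End Components.

Section VectorComponents.
Variables (k : fieldType) (F : 'rV[{mpoly k[3]}]_3) (d : 'I_3 -> nat).
Hypothesis hF : forall j, F 0 j \is (d j).-homog.
Local Notation pih := (pihomog mdeg).

Definition component (a : 'rV[{mpoly k[3]}]_3) E : 'rV[{mpoly k[3]}]_3 :=
  \row_j if (d j <= E)%N then pih (E - d j) (a 0 j) else 0.

Lemma dot_component a E : dot (component a E) F = pih E (dot a F).
Proof.
rewrite /dot raddf_sum; apply: eq_bigr => j _; rewrite mxE /= (pihomogM_homog _ _ (hF j)).
by case: ifP => // _; rewrite mul0r.
Qed.

Lemma component_homog a E j :
  if (d j <= E)%N then component a E 0 j \is (E - d j).-homog
  else component a E 0 j == 0.
Proof. by rewrite mxE; case: (d j <= E)%N => //; apply: pihomogP. Qed.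

Lemma inideal_pihomog x E : inideal F x -> inideal F (pih E x).
Proof. by move=> [w ->]; exists (component w E); rewrite dot_component. Qed.

Lemma component_saturated (a : 'rV[{mpoly k[3]}]_3) E i j N :
  inideal F ('X_i ^+ N * a 0 j) -> inideal F ('X_i ^+ N * component a E 0 j).
Proof.
rewrite mxE; case: ifP => [_|_ _]; last first.
  by rewrite mulr0; apply: ideal_pred0 (inideal_ideal F).
move=> /(inideal_pihomog (E - d j + N)).
rewrite mulrC (pihomogM_homog _ _ (dhomog_Xn _ _ _)) leq_addl addnK.
by rewrite mulrC.
Qed.

Lemma component_sum (a : 'rV[{mpoly k[3]}]_3) : exists B, a = \sum_(E < B) component a E.
Proof.
pose K := (\sum_j (d j + msize (a 0%R j)))%N; exists K; apply/rowP => j.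
have leK : (d j + msize (a 0%R j) <= K)%N by rewrite /K (bigD1 j) //= leq_addr.
rewrite summxE; pose c l := if (d j <= l)%N then pih (l - d j) (a 0 j) else 0.
transitivity (\sum_(l < K) c l); last by apply: eq_bigr => l _; rewrite mxE.
have leKd : (msize (a 0%R j) <= K - d j)%N by lia.
rewrite {1}(pihomog_partitionE leKd).
have -> : (K = d j + (K - d j))%N by lia.
rewrite big_split_ord /= [X in _ = X + _]big1 ?add0r => [|l _]; last first.
  by rewrite /c leqNgt ltn_ord.
by rewrite addKn; apply: eq_bigr => l _; rewrite /c leq_addr addKn.
Qed.

End VectorComponents.

(** * From primes of a chart to points of the plane *)

Section PointOfChart.
Variables (k : fieldType) (i : 'I_3).
Local Notation R := {mpoly k[3]}.
Local Notation S := {poly {poly k}}.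
Local Notation ch := (@chart k i).
Local Notation pih := (pihomog mdeg).

Definition graded_const : {rmorphism k -> {poly S}} :=
  GRing.RMorphism.clone _ _
    ((@polyC S : {rmorphism _ -> _}) \o (polyC2 k : {rmorphism _ -> _})) _.

(* Sends the homogeneous component of degree [d] to a multiple of ['X^d], so  *)
(* that homogeneous primes are traced back from primes of the chart.          *)
Definition graded_chart : {rmorphism R -> {poly S}} :=
  GRing.RMorphism.clone _ _
    (mmap graded_const (fun j : 'I_3 => (ch 'X_j)%:P * 'X)) _.

Lemma graded_chartX m : graded_chart 'X_[m] = (ch 'X_[m])%:P * 'X^(mdeg m).
Proof.
rewrite /graded_chart /= mmapX /mmap1 mdegE mpolyXE_id rmorph_prod rmorph_prod.
rewrite -prodrXr -big_split; apply: eq_bigr => j _ /=.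
by rewrite exprMn !rmorphXn.
Qed.

Lemma coef_graded_chart F n : (graded_chart F)`_n = ch (pih n F).
Proof.
rewrite [in LHS](mpolyE F) (rmorph_sum graded_chart) coef_sum.
have -> : pih n F = \sum_(m <- msupp F) F@_m *: pih n 'X_[m].
  rewrite {1}(mpolyE F) raddf_sum; apply: eq_bigr => m _; exact: linearZ.
rewrite (rmorph_sum ch); apply: eq_bigr => m _.
rewrite pihomogX -mul_mpolyC (rmorphM graded_chart) graded_chartX.
have -> : graded_chart (F@_m)%:MP = (ch (F@_m)%:MP)%:P.
  by rewrite /graded_chart /= mmapC chartC.
rewrite mulrA -polyCM coefCM coefXn -rmorphM.
rewrite [n == _]eq_sym; case: (mdeg m == n); first by rewrite mulr1 mul_mpolyC.
by rewrite mulr0 scaler0 rmorph0.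
Qed.

(** The point consists of the polynomials all of whose components dehomogenize into [M]. It is prime
    because these images are the coefficients of [graded_chart], to which Gauss's lemma applies. *)
Lemma point_of_chart (M : S -> Prop) : prime_pred M ->
  exists p : proj_point k, 'X_i \notin p /\
    forall d H, H \is d.-homog -> (H \in p <-> M (ch H)).
Proof.
move=> pM; pose P F := forall n, M (graded_chart F)`_n.
have pP : prime_pred P.
  split; first split.
  - by move=> n; rewrite rmorph0 coef0; apply: ideal_pred0 pM.
  - by move=> a b Pa Pb n; rewrite (rmorphD graded_chart) coefD; apply: (ideal_predD pM).
  - move=> a b Pb n; rewrite rmorphM coefM; apply: ideal_pred_sum => [|l _].
      exact: pM.
    by apply: (ideal_predM pM).
  - by move=> /(_ 0%N); rewrite rmorph1 coef1; apply: prime_pred1 pM.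
  - move=> a b Pab; apply: (prime_pred_coef pM) => n.
    by rewrite -rmorphM.
have [Q HQ] := prime_pred_idealr pP.
have HQd d H : H \is d.-homog -> (H \in Q <-> M (ch H)).
  move=> hH; rewrite HQ; split=> [/(_ d)|MH n].
    by rewrite coef_graded_chart pihomog_dE.
  rewrite coef_graded_chart; have [<-|dn] := eqVneq d n; first by rewrite pihomog_dE.
  by rewrite (pihomog_ne0 dn hH) rmorph0; apply: ideal_pred0 pM.
have hom f d : f \in Q -> pih d f \in Q.
  move=> /HQ Pf; apply/(HQd d); first exact: pihomogP.
  by rewrite -coef_graded_chart.
have XQ : 'X_i \notin Q.
  apply/negP => /(HQd 1%N); rewrite dhomogX /= mdeg1 chartXi => H.
  by apply: (prime_pred1 pM); apply: H.
by exists (ProjPoint hom (ex_intro _ i XQ)).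
Qed.

End PointOfChart.

(** * The theorem *)

Section LciImpliesKoszul.
Variables (k : fieldType) (F : 'rV[{mpoly k[3]}]_3) (d : 'I_3 -> nat).
Hypothesis hF : forall j, F 0 j \is (d j).-homog.
Variable I : set {mpoly k[3]}.
Hypothesis IE : forall x, I x <-> inideal F x.
Hypothesis lci : local_complete_intersection I.

(** The multipliers [t] that make [a] Koszul form an ideal [J] containing the entries of [f]. If [J]
    were proper, a prime above it would give a point of the base locus, where the local result
    yields a multiplier outside of that prime. *)
Lemma lci_chart_koszul i (a : 'rV[{poly {poly k}}]_3) :
  let f := map_mx (@chart k i) F in
  dot a f = 0 -> (forall j, inideal f (a 0 j)) -> koszul f a.
Proof.
move=> f af Ia; pose J t := koszul f (t *: a).
have iJ : ideal_pred J.
  split.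
  - by exists 0; rewrite scale0r cross0l.
  - by move=> s t Js Jt; rewrite /J scalerDl; apply: koszulD.
  - by move=> s t Jt; rewrite /J -scalerA; apply: koszulZ.
suff : J 1 by rewrite /J scale1r.
apply: contrapT => J1; have [M pM JM] := exists_prime_above iJ J1.
have [p [Xip pE]] := point_of_chart i pM.
have Fp j : F 0 j \in p.
  apply/(pE _ _ (hF j))/JM; exists (cross (delta_mx 0 j) a).
  by rewrite -koszul_mul // dot_deltal mxE.
have Ip : I `<=` [set` point_ideal p].
  move=> x /IE [w ->]; rewrite /= /dot; apply: rpred_sum => j _.
  exact: idealMr.
have [t [nMt Jt]] := lci_koszul hF Xip IE (lci Ip) af Ia.
apply: nMt; have [D HD] := @chart_lift k i t.
have [T hT ET] := HD _ (leqnn _).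
by exists D, T; split=> //; apply/(pE _ _ hT); rewrite ET; apply: JM.
Qed.

(** The vector is first cut into homogeneous components, which can be compared with their charts;
    there ['X_i] becomes 1, so saturation turns into membership. *)
Lemma lci_koszul_global (a : 'rV[{mpoly k[3]}]_3) : common_divisor_free F ->
  dot a F = 0 -> (forall j i, exists N, inideal F ('X_i ^+ N * a 0 j)) ->
  koszul F a.
Proof.
move=> cdf aF sat; have [B ->] := component_sum d a.
suff H E : koszul F (component d a E).
  by elim/big_ind: _ => // [|x y]; [exists 0; rewrite cross0l|exact: koszulD].
apply: koszul_saturated => // i.
apply: (koszul_of_chart hF (E := E)) => [j|].
  exact: component_homog.
apply: lci_chart_koszul => [|j].
  by rewrite -map_dot (dot_component hF) aF raddf0 rmorph0.
have [N /(component_saturated hF E) [w Ew]] := sat j i.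
exists (map_mx (@chart k i) w).
rewrite -map_dot -Ew rmorphM rmorphXn chartXi expr1n mul1r.
by rewrite [LHS]mxE.
Qed.

End LciImpliesKoszul.

(** * Translation of the definitions of the statement *)

Section Translation.
Variables (k : fieldType) (f1 f2 f3 : {mpoly k[3]}).
Local Notation F := (row3 f1 f2 f3).
Local Notation I := (ideal_gen [set f1; f2; f3]).

(** Up to sign, the three generators are the cross products of the unit vectors with [F]. *)
Lemma koszul_syzygiesE a : koszul_syzygies f1 f2 f3 a <-> koszul F a.
Proof.
split=> [[n [c [g [Hg ->]]]]|[e ->]].
  elim/big_ind: _ => [||i _]; first by exists 0; rewrite cross0l.
    exact: koszulD.
  apply: koszulZ; case: (Hg i) => [[->|->]|->].
  - exists (row3 0 0 (-1)); apply/rowP => j; rewrite !mxE.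
    by case: j => [[|[|[|//]]] ?] /=; ring.
  - exists (row3 0 1 0); apply/rowP => j; rewrite !mxE.
    by case: j => [[|[|[|//]]] ?] /=; ring.
  - exists (row3 (-1) 0 0); apply/rowP => j; rewrite !mxE.
    by case: j => [[|[|[|//]]] ?] /=; ring.
exists 3, (fun i : 'I_3 => [tuple - e 0 2%:R; e 0 1; - e 0 0]`_i).
exists (fun i : 'I_3 =>
  [tuple row3 f2 (- f1) 0; row3 f3 0 (- f1); row3 0 f3 (- f2)]`_i).
split.
  by case=> [[|[|[|//]]] ?]; [left; left|left; right|right].
rewrite (big_ord3 _ 0) (_ : cross e F = - e 0 2%:R *: row3 f2 (- f1) 0 +
  (e 0 1 *: row3 f3 0 (- f1) + - e 0 0 *: row3 0 f3 (- f2))) //.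
have eE (x y : 'I_3) : x = y :> nat -> e 0 x = e 0 y by move/val_inj => ->.
apply/rowP => j; rewrite !mxE; case: j => [[|[|[|//]]] ltj] /=.
- by rewrite (eE _ 1) // (eE (Ordinal ltj + 2%:R) 2%:R) //; ring.
- by rewrite (eE _ 2%:R) // (eE (Ordinal ltj + 2%:R) 0) //; ring.
- by rewrite (eE _ 0) // (eE (Ordinal ltj + 2%:R) 1) //; ring.
Qed.

Lemma Xn_ideal_exp (i : 'I_3) n : ideal_exp (@irrelevant_ideal k) n ('X_i ^+ n).
Proof.
elim: n => [|n IHn]; first by rewrite /ideal_exp.
rewrite /ideal_exp iterS; apply: ideal_gen_mem.
exists 'X_i, ('X_i ^+ n); split=> //; last by rewrite exprS.
by apply: ideal_gen_mem; exists i.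
Qed.

Lemma saturation_inideal x i : saturation I x ->
  exists N, inideal F ('X_i ^+ N * x).
Proof.
by move=> [N HN]; exists N; apply/inideal_genE/HN; apply: Xn_ideal_exp.
Qed.

Lemma inideal_saturation x : inideal F x -> saturation I x.
Proof.
move=> Fx; exists 0%N => g _; apply/inideal_genE.
by apply: ideal_predM => //; apply: inideal_ideal.
Qed.

End Translation.

Theorem theorem1p7 (k : fieldType) (f1 f2 f3 : {mpoly k[3]}) (d1 d2 d3 : nat)
    (hf1 : f1 \is d1.-homog) (hf2 : f2 \is d2.-homog) (hf3 : f3 \is d3.-homog)
    (hcodim : has_codim (ideal_gen [set f1; f2; f3]) 2) :
  koszul_syzygies f1 f2 f3 = vanishing_syzygies f1 f2 f3 <->
  local_complete_intersection (ideal_gen [set f1; f2; f3]).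
Proof.
set F := row3 f1 f2 f3; pose d (j : 'I_3) := [tuple d1; d2; d3]`_j.
have hF j : F 0 j \is (d j).-homog.
  by rewrite mxE /d; case: j => [[|[|[|//]]] ?].
have IE x : ideal_gen [set f1; f2; f3] x <-> inideal F x := inideal_genE f1 f2 f3 x.
(* Codimension two yields grade at least two. *)
have cdf : common_divisor_free F.
  apply: codim_cdf => P FP; apply: hcodim.1 => x /IE [w ->] /=.
  by apply: rpred_sum => j _; apply: idealMr.
split=> [KV p Ip|lci].
  have [i Xip] := point_relevant p.
  apply: (stalk_regular hF Xip IE cdf) => [a aF Ia|j].
    apply/koszul_syzygiesE; rewrite KV; split=> // j.
    exact: inideal_saturation.
  by apply: Ip; apply/IE; apply: inideal_gen.
apply/seteqP; split=> a.
  (* Koszul syzygies always have entries in the ideal, hence in its saturation. *)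
  move/koszul_syzygiesE => [e ->]; split; first exact: dot_crossv.
  move=> j; apply: inideal_saturation; rewrite mxE.
  have iI := inideal_ideal F.
  apply: ideal_predB => //; apply: ideal_predM => //; exact: inideal_gen.
move=> [aF sat]; apply/koszul_syzygiesE.
apply: (lci_koszul_global hF IE lci cdf aF) => j i.
exact: saturation_inideal.
Qed.
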